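(* Let $f:2^{[n]}\to\mathbb{R}_{\ge0}$ be any non-negative submodular function, let $\mathcal{M}\subseteq 2^{[n]}$ be any matroid with rank $r\in\mathbb{N}^+$, and let $\varepsilon\in(0,\tfrac12)$. Run Algorithm Greedy-Filtering (described in the context) on $(f,\mathcal M,r,\pi,\varepsilon)$, where $\pi$ is a uniformly random permutation of $[n]$ giving the arrival order of a random-order stream. Then the algorithm achieves a $\tfrac12-\varepsilon'$ approximation, i.e. its output $X_{\mathrm{ALG}}\in\mathcal M$ satisfies $\mathbb{E}[f(X_{\mathrm{ALG}})]\ge(\tfrac12-\varepsilon')\cdot\max_{X\in\mathcal M}f(X)$ (expectation over $\pi$), where $\varepsilon'=8\sqrt{2\varepsilon+\frac{2r}{n}}$, and it uses $O\!\left(\frac{r\ln(r/\varepsilon)^2}{\varepsilon^2}\right)$ memory.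
   Context: Notation: $f(X|Y):=f(X\cup Y)-f(Y)$. $f$ is submodular if $f(X|Y)\ge f(X|Z)$ for all $X\subseteq[n]$ and $Y\subseteq Z\subseteq[n]$. A matroid $\mathcal M\subseteq2^{[n]}$ is a nonempty family of independent sets closed under subsets and satisfying the exchange axiom; its rank is $\max_{X\in\mathcal M}|X|$. $f$ is accessed through a value oracle and $\mathcal M$ through a membership oracle. For a finite nonempty $I\subset\mathbb R$, the rounding operator is $\lfloor a\rfloor_I:=\max\{i\in I: i\le a\}$ if $a\ge\min I$, and $\lfloor a\rfloor_I:=\min I$ otherwise. Random-order streaming model: elements arrive in the order $\pi(1),\dots,\pi(n)$; the algorithm keeps a memory buffer of elements, may query the oracles arbitrarily on subsets of stored elements, and at the end outputs a set of stored elements in $\mathcal M$. Memory is the number of stored elements. Algorithm Greedy-Filtering$(f,\mathcal M,r,\pi,\varepsilon)$: Throughout the stream it maintains the set $T$ of the top $\lceil \ln(1/\varepsilon)/\varepsilon\rceil$ elements with highest singleton value $f(\{e\})$ among arrived elements (ties: keep the earliest arrived). Phase 1: $V_0:=\{\pi(1),\dots,\pi(\lceil\varepsilon n\rceil)\}$ and $w:=\frac{r}{\varepsilon}\max_{e\in V_0}f(\{e\})$. Phase 2: for $i\in[r]$, $V_i:=\{\pi(j): j=\lceil\varepsilon n\rceil+(i-1)\lceil\varepsilon n/r\rceil+1,\dots,\lceil\varepsilon n\rceil+i\lceil\varepsilon n/r\rceil\}$; $s_1:=\arg\max_{e\in V_1}f(\{e\})$, $S_0:=\emptyset$, $S_1:=\{s_1\}$;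 for $i=2,\dots,r$: $s_i:=\arg\max\{f(\{e\}|S_{i-1}): e\in V_i\cup\{s_1\},\ S_{i-1}\cup\{e\}\in\mathcal M\}$ and $S_i:=S_{i-1}\cup\{s_i\}$. Phase 3: $I:=\{(1+\varepsilon)^i\varepsilon^2w/r^2: i\in\{0,\dots,\lceil 2\log_{1+\varepsilon}(r/\varepsilon)\rceil\}\}$, $H:=\emptyset$; for $j=\lceil\varepsilon n\rceil+r\lceil\varepsilon n/r\rceil+1,\dots,n$ in order: if there is $i\in[r]$ with $S_{i-1}\cup\{\pi(j)\}\in\mathcal M$ and $\lfloor f(\{\pi(j)\}|S_{i-1})\rfloor_I>\lfloor f(\{s_i\}|S_{i-1})\rfloor_I$, add $\pi(j)$ to $H$; if $|H|>\frac{r\ln(r/\varepsilon)|I|}{\varepsilon}$, stop the loop. Output $X_{\mathrm{ALG}}:=\arg\max\{f(X): X\subseteq T\cup S_r\cup H,\ X\in\mathcal M\}$.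
   Formalization: Elements e with {e} not in the matroid (loops) are ignored when forming T, w and s_1; without this, many high-value loops make the claim false. For loopless matroids the algorithm is unchanged. *)

(* Defs.v *)
From HB Require Import structures.
From mathcomp Require Import all_boot all_order all_algebra all_fingroup.
From mathcomp Require Import reals exp.

Set Implicit Arguments.
Unset Strict Implicit.
Unset Printing Implicit Defensive.

Import Order.TTheory GRing.Theory Num.Theory.
Local Open Scope ring_scope.

(* The ground set [n] is 'I_n, and a stream is a sequence over 'I_n. *)

Definition marginal (R : realType) (n : nat) (f : {set 'I_n} -> R)
    (X Y : {set 'I_n}) : R :=
  f (X :|: Y) - f Y.

(* X is taken disjoint from Z, as is standard.  Without this restriction, the
   case X = Z :\: Y gives f Y <= f Z, so only monotone functions would remain;
   those are covered here as a special case. *)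
Definition submodular (R : realType) (n : nat) (f : {set 'I_n} -> R) : Prop :=
  forall X Y Z : {set 'I_n}, Y \subset Z -> [disjoint X & Z] ->
    marginal f X Z <= marginal f X Y.

Definition matroid (n : nat) (M : {set {set 'I_n}}) : Prop :=
  [/\ M != set0,
      forall X Y : {set 'I_n}, X \subset Y -> Y \in M -> X \in M &
      forall X Y : {set 'I_n}, X \in M -> Y \in M -> (#|X| < #|Y|)%N ->
        exists2 y, y \in Y :\: X & y |: X \in M].

Definition matroid_rank (n : nat) (M : {set {set 'I_n}}) : nat :=
  \max_(X in M) #|X|.

(* The default 0 plays no role when f is non-negative and M is nonempty. *)
Definition opt (R : realType) (n : nat) (f : {set 'I_n} -> R)
    (M : {set {set 'I_n}}) : R :=
  \big[Num.max/0]_(X in M) f X.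

(* Only used for non-negative arguments. *)
Definition ceil_nat (R : realType) (x : R) : nat := `|Num.ceil x|%N.

Definition seq_min (R : realType) (I : seq R) : R :=
  \big[Num.min/head 0 I]_(i <- I) i.

(* The default value is only reached when a < min I: if min I <= a then min I
   itself is one of the terms of the maximum. *)
Definition rounding (R : realType) (I : seq R) (a : R) : R :=
  \big[Num.max/seq_min I]_(i <- I | i <= a) i.

(* The earliest element of s maximising g. *)
Definition first_argmax (R : realType) (T : Type) (g : T -> R) (s : seq T) :
    option T :=
  ohead [seq x <- s | all (fun y => g y <= g x) s].

Definition set_of_option (T : finType) (o : option T) : {set T} :=
  [set x | o == Some x].

Section GreedyFiltering.

(* The quantities below are functions of the sequence p of the elements arrived
   so far; evaluating them at a prefix of the stream gives what the algorithm
   holds at that time, and evaluating them at the whole stream its final result.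

   Elements e with [set e] \notin M (loops) can never be output, and are ignored
   wherever singleton values are compared.  This is vacuous for a loopless
   matroid; with loops it is needed, since loops of large value could otherwise
   fill T, inflate w and be selected as s_1. *)
Context {R : realType} {n : nat} (f : {set 'I_n} -> R) (M : {set {set 'I_n}}).
Context (r : nat) (eps : R) (p : seq 'I_n).

Definition top_size : nat := ceil_nat (ln eps^-1 / eps).

(* [sort] is stable, so ties are resolved in favour of the earliest arrival. *)
Definition gf_T : {set 'I_n} :=
  [set e in take top_size
     (sort (fun x y => f [set y] <= f [set x]) [seq e <- p | [set e] \in M])].

Definition phase1_len : nat := ceil_nat (eps * n%:R).
Definition window_len : nat := ceil_nat (eps * n%:R / r%:R).

Definition gf_V0 : seq 'I_n := take phase1_len p.

(* The windows V_i, for 1 <= i <= r. *)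
Definition gf_V (i : nat) : seq 'I_n :=
  take window_len (drop (phase1_len + i.-1 * window_len) p).

Definition gf_w : R :=
  r%:R / eps * \big[Num.max/0]_(e <- gf_V0 | [set e] \in M) f [set e].

Definition gf_s1 : option 'I_n :=
  first_argmax (fun e => f [set e]) [seq e <- gf_V 1 | [set e] \in M].

(* The selection of s_i given S = S_{i-1}. *)
Definition gf_select (i : nat) (S : {set 'I_n}) : option 'I_n :=
  if i == 1%N then gf_s1
  else first_argmax (fun e => marginal f [set e] S)
         [seq e <- seq_of_opt gf_s1 ++ gf_V i | e |: S \in M].

Fixpoint gf_S (i : nat) : {set 'I_n} :=
  if i is j.+1 then gf_S j :|: set_of_option (gf_select i (gf_S j)) else set0.

(* The set {s_i}, which is empty if there was no candidate for s_i; the marginal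
   value of s_i is then 0. *)
Definition gf_s (i : nat) : {set 'I_n} :=
  set_of_option (gf_select i (gf_S i.-1)).

Definition gf_I : seq R :=
  [seq (1 + eps) ^+ k * eps ^+ 2 * gf_w / r%:R ^+ 2
  | k <- iota 0 (ceil_nat (2 * (ln (r%:R / eps) / ln (1 + eps)))).+1].

(* gf_I has repetitions when gf_w = 0. *)
Definition card_I : nat := size (undup gf_I).

Definition gf_cap : R := r%:R * ln (r%:R / eps) * card_I%:R / eps.

Definition gf_accept (e : 'I_n) : bool :=
  [exists i : 'I_r, (e |: gf_S i \in M) &&
    (rounding gf_I (marginal f (gf_s i.+1) (gf_S i)) <
     rounding gf_I (marginal f [set e] (gf_S i)))].

(* Once #|H| exceeds gf_cap, H no longer changes: this is the early stop. *)
Definition gf_step (H : {set 'I_n}) (e : 'I_n) : {set 'I_n} :=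
  if gf_cap < #|H|%:R then H else if gf_accept e then e |: H else H.

Definition gf_H : {set 'I_n} :=
  foldl gf_step set0 (drop (phase1_len + r * window_len) p).

Definition gf_stored : {set 'I_n} := gf_T :|: gf_S r :|: gf_H.

Definition gf_output : {set 'I_n} :=
  [arg max_(X > set0 | (X \subset gf_stored) && (X \in M)) f X]%O.

End GreedyFiltering.

Definition stream (n : nat) (pi : 'S_n) : seq 'I_n := [seq pi j | j <- enum 'I_n].

Definition expectation_perm (R : realType) (n : nat) (X : 'S_n -> R) : R :=
  (\sum_(pi : 'S_n) X pi) / (n`!)%:R.

(* buf t is the content of the memory after t arrivals: an element can only be
   in memory if it just arrived or was already there, and the output is made of
   elements in memory at the end. *)
Definition streams_with_memory (R : realType) (n : nat) (pi : 'S_n)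
    (buf : nat -> {set 'I_n}) (out : {set 'I_n}) (m : R) : Prop :=
  [/\ buf 0%N = set0,
      forall t : 'I_n, buf t.+1 \subset pi t |: buf t,
      out \subset buf n &
      forall t : nat, (t <= n)%N -> #|buf t|%:R <= m].

(* Main.v *)
Require Import Defs.
From HB Require Import structures.
From mathcomp Require Import all_boot all_order all_algebra all_fingroup.
From mathcomp Require Import reals sequences exp.
From mathcomp Require Import lra zify ring.

(* Let [D] be the set of elements arriving in phases 1 and 2, [S] the greedy set
   and [O] an optimal solution; each element lies in [D] with probability at most
   [delta = 2 eps + 2 r / n].  As [S] is contained in [D], the sampling lemma for
   non-negative submodular functions gives
   [E f ((O \ D) + S) >= (1 - 2 delta) f O], monotone or not.
   For a fixed order, let [H] be the stored part of [O \ D].  Each lost element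
   [e] is exchanged, along the greedy chain, for an [s_i] outside the span of
   [H + S_(i-1)]; the filter makes the marginal value of [e] at most that of [s_i],
   up to rounding.  The [s_i] that are spanned are charged to [f S] as well, so
   [f ((O \ D) + S) <= f A + f S] up to [O(eps)], where [A], made of [H] and the
   other [s_i], is independent and stored: one of the two is at least half.
   This fails only if the sample of phase 1 misses the [top_size] largest
   singletons, or if the i-th window misses the largest
   [(r / eps) ln (r / eps)] marginal values for some i, which has probability
   at most [2 eps]; otherwise [H] is never stopped early. *)

Set Implicit Arguments.
Unset Strict Implicit.
Unset Printing Implicit Defensive.

Import Order.TTheory GRing.Theory Num.Theory.
Local Open Scope ring_scope.

(** * Submodular functions *)

Section SetFunctions.
Variables (R : realType) (n : nat).
Implicit Types (f g : {set 'I_n} -> R) (A B X Y Z U : {set 'I_n}) (e : 'I_n).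

Definition lattice_submodular g :=
  forall A B, g (A :|: B) + g (A :&: B) <= g A + g B.

(** Diminishing returns for [A :\: B], disjoint from [B], over the nested pair [A :&: B] and [B]. *)
Lemma submodular_lattice f : submodular f -> lattice_submodular f.
Proof.
move=> sf A B; have := sf (A :\: B) (A :&: B) B (subsetIr _ _).
have -> : [disjoint A :\: B & B]
  by rewrite -setI_eq0; apply/eqP/setP=> x; rewrite !inE;
    case: (x \in B); rewrite ?andbF.
rewrite /marginal.
have -> : A :\: B :|: A :&: B = A by rewrite setUC setID.
have -> : A :\: B :|: B = A :|: B
  by apply/setP=> x; rewrite !inE; case: (x \in B); rewrite ?orbT ?andbT ?orbF.
by move/(_ isT); lra.
Qed.

Lemma marginal1_antimono f Y Z e :
  lattice_submodular f -> Y \subset Z -> e \notin Z ->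
  marginal f [set e] Z <= marginal f [set e] Y.
Proof.
move=> sf sYZ eZ; have := sf (e |: Y) Z; rewrite /marginal.
rewrite -setUA (setUidPr sYZ) setIUl (setIidPl sYZ).
suff -> : [set e] :&: Z = set0 by rewrite set0U; lra.
by apply: disjoint_setI0; rewrite disjoints1.
Qed.

Lemma marginal1_in f Z e : e \in Z -> marginal f [set e] Z = 0.
Proof. by move=> eZ; rewrite /marginal (setUidPr _) ?sub1set // subrr. Qed.

Lemma le_sum_marginal f Y Z : lattice_submodular f ->
  f (Z :|: Y) <= f Z + \sum_(e in Y) marginal f [set e] Z.
Proof.
move=> sf; have [m] := ubnP #|Y|; elim: m Y => // m IH Y.
have [->|[e eY]] := set_0Vmem Y; first by rewrite setU0 big_set0 addr0.
rewrite (big_setD1 e eY) /= (cardsD1 e) eY ltnS => /IH.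
set s := \sum_(i in _) _; move=> IHY.
suff : f (Z :|: Y) <= f (Z :|: Y :\ e) + marginal f [set e] Z by lra.
have YE : Z :|: Y = e |: (Z :|: Y :\ e) by rewrite setUCA setD1K.
have [eZ|eZ] := boolP (e \in Z).
  by rewrite marginal1_in // addr0 YE (setUidPr _) // sub1set inE eZ.
have := @marginal1_antimono f Z (Z :|: Y :\ e) e sf (subsetUl _ _).
by rewrite !inE eqxx (negPf eZ) => /(_ isT); rewrite {1}/marginal -YE; lra.
Qed.

(** Counting form of the sampling lemma on the uniform space [T], with arbitrary dependence between
    elements. Only [t = 0] is applied later; a general lower frequency [t] makes the induction on
    [U] work. *)
Lemma submodular_sampling (T : finType) (g : {set 'I_n} -> R) (D : T -> {set 'I_n})
    (P t : R) U :
  (forall A, 0 <= g A) -> lattice_submodular g ->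
  (forall w, D w \subset U) ->
  (forall e, e \in U -> t <= #|[set w | e \in D w]|%:R <= P) -> t <= P ->
  (#|T|%:R - P) * g set0 + t * g U <= \sum_w g (D w).
Proof.
move=> g0 sg; have [m] := ubnP #|U|; elim: m U D t => // m IH U D t ltU DU cU tP.
have [U0|[e0 e0U]] := set_0Vmem U.
  under eq_bigr => w _.
    have -> : D w = set0 by apply/eqP; rewrite -subset0 -U0.
    over.
  rewrite sumr_const U0 -(mulr_natl (g set0)).
  by rewrite -mulrDl ler_wpM2r ?g0 //; lra.
pose c e := #|[set w | e \in D w]|.
(* The least frequent element [m0] is removed everywhere; its count [q] becomes the lower frequency
   of the others. *)
have [m0 m0U minm0] := @arg_minnP _ e0 [in U] c e0U.
set q : R := (c m0)%:R.
have qP : t <= q <= P by apply: cU.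
pose D' w := D w :\ m0.
have IHq : (#|T|%:R - P) * g set0 + q * g (U :\ m0) <= \sum_w g (D' w).
  apply: IH.
  - by move: ltU; rewrite (cardsD1 m0) m0U.
  - by move=> w; apply: setSD.
  - move=> e; rewrite !inE => /andP[em0 eU].
    have -> : [set w | e \in D' w] = [set w | e \in D w].
      by apply/setP=> w; rewrite !inE em0.
    by rewrite ler_nat (minm0 e eU) /=; case/andP: (cU e eU).
  - by case/andP: qP.
(* Putting [m0] back gains at least its marginal value over the larger set [U :\ m0]. Summed over
   [w], this turns [q * g (U :\ m0)] into [q * g U]. *)
have step w : g (D' w) + (m0 \in D w)%:R * (g U - g (U :\ m0)) <= g (D w).
  have [mD|mD] := boolP (m0 \in D w); last first.
    rewrite mul0r addr0 /D'; suff -> : D w :\ m0 = D w by [].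
    by apply/setDidPl; rewrite disjoint_sym disjoints1.
  rewrite mul1r /D'.
  have := @marginal1_antimono g (D w :\ m0) (U :\ m0) m0 sg (setSD _ (DU w)).
  by rewrite !inE eqxx /= /marginal !setD1K // => /(_ isT); lra.
have : \sum_w (g (D' w) + (m0 \in D w)%:R * (g U - g (U :\ m0))) <= \sum_w g (D w).
  by apply: ler_sum => w _.
rewrite big_split /= -mulr_suml.
have -> : \sum_w (m0 \in D w)%:R = q :> R.
  rewrite -natr_sum /q /c -sum1_card [in RHS]big_mkcond /=; congr (_%:R).
  by apply: eq_bigr => w _; rewrite inE; case: (_ \in _).
have : 0 <= (q - t) * g U by rewrite mulr_ge0 ?g0 //; lra.
rewrite mulrBl mulrBr; lra.
Qed.

End SetFunctions.

(** * Matroids and the charging argument *)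

Section Matroid.
Variables (n : nat) (M : {set {set 'I_n}}).
Hypothesis matM : matroid M.
Implicit Types (A B S : {set 'I_n}) (e : 'I_n).

Lemma matroid_set0 : set0 \in M.
Proof.
case: matM => /set0Pn[X XM] sM _; exact: sM (sub0set _) XM.
Qed.

Lemma matroid_card_le A : A \in M -> (#|A| <= matroid_rank M)%N.
Proof. by move=> AM; apply: (@leq_bigmax_cond _ [in M] (fun X : {set 'I_n} => #|X|)). Qed.

Lemma matroid_extend A B : A \in M -> B \in M ->
  exists C, [/\ C \in M, A \subset C, C \subset A :|: B & (#|B| <= #|C|)%N].
Proof.
case: matM => _ _ exM AM BM.
have [|C /maxsetP[/andP[CM sC] maxC] sAC] :=
  @maxset_exists _ [pred C | (C \in M) && (C \subset A :|: B)] A.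
  by rewrite /= AM subsetUl.
exists C; split=> //; rewrite leqNgt; apply/negP => ltCB.
have [y /setDP[yB yC] yCM] := exM _ _ CM BM ltCB.
have := maxC (y |: C); rewrite /= yCM subUset sub1set !inE yB orbT sC subsetU1.
by move=> /(_ isT isT) E; move: yC; rewrite -E !inE eqxx.
Qed.

(** For [A] in [M] this says that [S] lies in the matroid closure of [A]. *)
Definition spanned A S := forall s, s \in S -> s \in A \/ s |: A \notin M.

Lemma spanned_card A S : A \in M -> S \in M -> spanned A S -> (#|S| <= #|A|)%N.
Proof.
case: matM => _ _ exM AM SM spA; rewrite leqNgt; apply/negP => lt.
have [y /setDP[yS yA] yM] := exM _ _ AM SM lt.
by case: (spA y yS); [rewrite (negPf yA)|rewrite yM].
Qed.

(** Extend [S] inside [S :|: (e |: A)] to at least [#|A| + 1] elements. An extension without [e]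
    would be spanned by [A], hence too small. *)
Lemma spanned_indep A S e : e |: A \in M -> S \in M -> spanned A S -> e \notin A ->
  e |: S \in M.
Proof.
case: (matM) => _ sM exM eAM SM spA eA.
have AM : A \in M by apply: sM eAM; rewrite subsetU1.
have [C [CM sSC sC leC]] := matroid_extend SM eAM.
have [eC|eC] := boolP (e \in C).
  by apply: sM CM; rewrite subUset sub1set eC.
have : spanned A C.
  move=> s /[dup] sCs /(subsetP sC); rewrite !inE => /or3P[/spA //|/eqP es|]; last by left.
  by rewrite -es sCs in eC.
move/(spanned_card AM CM); rewrite leqNgt; case/negP.
by apply: leq_trans leC; rewrite cardsU1 eA.
Qed.

(** Extending [e |: A] from [A :|: B] reaches size at least [#|A| + #|B|], so the new element
    displaces at most one element of [B]. *)
Lemma matroid_swap A B e : A :|: B \in M -> [disjoint A & B] -> e |: A \in M ->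
    e \notin A -> e \notin B ->
  exists2 B' : {set 'I_n}, B' \subset B & (e |: A) :|: B' \in M /\ (#|B :\: B'| <= 1)%N.
Proof.
move=> ABM dAB eAM eA eB.
have [C [CM sAC sC leC]] := matroid_extend eAM ABM.
have sAB : (e |: A) :|: (C :&: B) \subset C.
  by rewrite subUset sAC subsetIl.
have CE : C \subset (e |: A) :|: (C :&: B).
  apply/subsetP=> x xC; have := subsetP sC x xC; rewrite !inE xC.
  by case: (x == e); case: (x \in A); case: (x \in B).
exists (C :&: B); first exact: subsetIr.
have {sAB CE} CE : C = (e |: A) :|: (C :&: B) by apply/eqP; rewrite eqEsubset CE sAB.
split; first by rewrite -CE.
have dI : [disjoint e |: A & C :&: B].
  rewrite disjoint_sym; apply: disjointWl (subsetIr _ _) _.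
  by rewrite disjoint_sym -setI_eq0 setIUl setU_eq0 !setI_eq0 disjoints1 eB.
have cU (X Y : {set 'I_n}) : [disjoint X & Y] -> #|X :|: Y| = (#|X| + #|Y|)%N.
  by move=> dXY; rewrite cardsU (disjoint_setI0 dXY) cards0 subn0.
move: leC; rewrite {1}CE (cU _ _ dI) (cU _ _ dAB) cardsU1 eA -(cardsID C B) [B :&: C]setIC.
have -> : B :\: (C :&: B) = B :\: C.
  by apply/setP=> x; rewrite !inE; case: (x \in B); rewrite ?andbF ?andbT.
by move: #|A| #|_| #|_| => a b c'; lia.
Qed.

End Matroid.

(** * Charging lost elements to the steps of a greedy chain *)

Section Charging.
Variables (R : realType) (n : nat) (f : {set 'I_n} -> R) (M : {set {set 'I_n}}).
Hypothesis matM : matroid M.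
Hypothesis sf : lattice_submodular f.
Variables (S : nat -> {set 'I_n}) (r : nat).
Hypothesis S0 : S 0 = set0.
Hypothesis S_step :
  forall i, S i.+1 = S i \/ exists2 s, s \notin S i & S i.+1 = s |: S i.

Lemma chain_subset i j : (i <= j)%N -> S i \subset S j.
Proof.
move/subnK <-; elim: (j - i)%N => // m /subset_trans -> //.
by rewrite addSn; case: (S_step (m + i)) => [->|[s _ ->]] //; apply: subsetUr.
Qed.

(** [P] keeps the elements added with positive gain; leaving out the others can only raise the
    marginal values of those kept. *)
Lemma positive_steps_le : exists2 P : {set 'I_n}, P \subset S r &
  f set0 + \sum_(i < r) Num.max (f (S i.+1) - f (S i)) 0 <= f P.
Proof.
elim: r => [|m [P sP IH]]; first by exists set0; rewrite ?sub0set // big_ord0 addr0.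
have sSm := chain_subset (leqnSn m).
rewrite big_ord_recr /=; case: (lerP (f (S m.+1) - f (S m)) 0) => d0.
  by exists P; rewrite ?addr0 //; apply: subset_trans sP sSm.
case: (S_step m) => [E|[s sS E]]; first by move: d0; rewrite E subrr ltxx.
exists (s |: P); first by rewrite E setUS.
have := marginal1_antimono sf sP sS; rewrite /marginal E in d0 *; lra.
Qed.

Variables (H rest : {set 'I_n}) (w : nat -> R) (mu : R).
Hypothesis S_indep : forall i, (i <= r)%N -> S i \in M.
Hypothesis HrestM : H :|: rest \in M.
Hypothesis dHrest : [disjoint H & rest].
Hypothesis dHS : [disjoint H & S r].
Hypothesis drestS : [disjoint rest & S r].
Hypothesis w_step : forall i, (i < r)%N -> Num.max (f (S i.+1) - f (S i)) 0 <= w i.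
Hypothesis w_rest : forall i e, (i < r)%N -> e \in rest -> e |: S i \in M ->
  marginal f [set e] (S i) <= w i.
Hypothesis w_idle : forall i, (i < r)%N -> S i.+1 = S i -> w i <= mu.

Lemma w_ge0 i : (i < r)%N -> 0 <= w i.
Proof. by move/w_step; rewrite ge_max => /andP[]. Qed.

(* [A] collects the stored elements [H] and the [s_i] not spanned by them; each
   [s_i] entering [A] pushes out at most one element of [rest], whose marginal
   value is charged to [s_i]. *)
Lemma charging_invariant i : (i <= r)%N -> exists A Q : {set 'I_n},
  [/\ H \subset A /\ A \subset H :|: S i, Q \subset rest, A :|: Q \in M,
     spanned M A (S i) &
     f (H :|: S i) + \sum_(e in rest :\: Q) marginal f [set e] (S r)
       <= f A + \sum_(j < i) w j].
Proof.
elim: i => [_|i IH ir].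
  exists H, rest; rewrite S0 setU0 setDv !big_set0 big_ord0; split=> //.
  by move=> s; rewrite inE.
have [A [Q [[sHA sA] sQ AQM spA IHv]]] := IH (ltnW ir).
have wi0 := w_ge0 ir.
rewrite big_ord_recr /=.
have [E|[s sS E]] := S_step i.
  by exists A, Q; rewrite E; split=> //; move: IHv wi0; lra.
have sSr : s \in S r.
  by apply: (subsetP (chain_subset ir)); rewrite E setU11.
have sH : s \notin H by apply/negP => sH; move/disjoint_setI0/setP/(_ s): dHS; rewrite !inE sH sSr.
have srest : s \notin rest.
  by apply/negP => sH'; move/disjoint_setI0/setP/(_ s): drestS; rewrite !inE sH' sSr.
have sA' : s \notin A.
  by apply/negP => /(subsetP sA); rewrite !inE (negPf sH) (negPf sS).
have sHS : s \notin H :|: S i by rewrite !inE negb_or sH sS.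
have HSE : H :|: S i.+1 = s |: (H :|: S i) by rewrite E setUCA.
(* If [s] cannot be added to [A], then [A] stays and the growth of [f (H :|: S i)] is charged to
   [w i]. *)
have [sAM|sAM] := boolP (s |: A \in M); last first.
  exists A, Q; split=> //.
  - by split=> //; apply: subset_trans sA _; rewrite setUS // E subsetUr.
  - by move=> x; rewrite E !inE => /orP[/eqP ->|/spA //]; right.
  - have := marginal1_antimono sf (subsetUr H (S i)) sHS.
    have := w_step ir; rewrite ge_max => /andP[+ _].
    rewrite /marginal -HSE -E; move: IHv; lra.
have dAQ : [disjoint A & Q].
  rewrite disjoint_sym; apply: disjointWl sQ _; rewrite disjoint_sym.
  apply: disjointWl sA _; rewrite -setI_eq0 setIUl setU_eq0 !setI_eq0 dHrest /=.
  by apply: disjointWl (chain_subset (ltnW ir)) _; rewrite disjoint_sym.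
(* Otherwise [s] joins [A]. As [A] lies in [H :|: S i], the growth of [f A] covers that of
   [f (H :|: S i)], and [w i] is left to pay for the displaced element. *)
have [|Q' sQ' [Q'M cQ']] := matroid_swap matM AQM dAQ sAM sA'.
  by apply: contra srest; apply: (subsetP sQ).
exists (s |: A), Q'; split=> //.
- by rewrite HSE setUS //; split=> //; apply: subset_trans sHA _; apply: subsetUr.
- exact: subset_trans sQ' sQ.
- move=> x; rewrite E !inE => /orP[->|/spA]; first by left.
  case=> [->|xA]; first by left; rewrite orbT.
  right; apply: contra xA; case: matM => _ sM _; apply: sM.
  by apply/subsetP => y; rewrite !inE => /orP[->|->] //; rewrite !orbT.
have sumE : \sum_(e in rest :\: Q') marginal f [set e] (S r) =
    \sum_(e in rest :\: Q) marginal f [set e] (S r) +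
    \sum_(e in Q :\: Q') marginal f [set e] (S r).
  have -> : rest :\: Q = (rest :\: Q') :\: Q.
    by rewrite setDDl (setUidPr sQ').
  have -> : Q :\: Q' = (rest :\: Q') :&: Q.
    by rewrite setIDAC (setIidPr sQ).
  by rewrite addrC -big_setID.
have : \sum_(e in Q :\: Q') marginal f [set e] (S r) <= w i.
  have [->|[e eQ]] := set_0Vmem (Q :\: Q'); first by rewrite big_set0.
  have -> : Q :\: Q' = [set e].
    by apply/esym/eqP; rewrite eqEcard sub1set eQ cards1.
  rewrite big_set1; move: eQ; rewrite inE => /andP[_ eQ].
  (* Since [e |: A] is independent and [A] spans [S i], also [e |: S i] is independent, and [w_rest]
     applies. *)
  have erest := subsetP sQ _ eQ.
  apply: le_trans (w_rest ir erest _).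
    apply: (marginal1_antimono sf (chain_subset (ltnW ir))).
    by apply/negP => eS; move/disjoint_setI0/setP/(_ e): drestS; rewrite !inE erest eS.
  apply: (@spanned_indep _ M matM A); rewrite ?S_indep ?(ltnW ir) //; last first.
    by apply/negP => eA; move/disjoint_setI0/setP/(_ e): dAQ; rewrite !inE eA eQ.
  case: matM => _ sM _; apply: sM AQM.
  by rewrite setUC setUS // sub1set.
have := marginal1_antimono sf sA sHS; rewrite /marginal -HSE sumE; move: IHv; lra.
Qed.

Hypothesis rank_r : matroid_rank M = r.
Hypothesis mu_ge0 : 0 <= mu.

(** Each element left in [Q] after the last step could be added to [S r], so its marginal value is
    at most the bound [mu] of an idle step; [Q] is independent, so there are at most [r] such
    terms. *)
Lemma charging : exists A : {set 'I_n}, [/\ A \in M, A \subset H :|: S r &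
  f ((H :|: rest) :|: S r) <= f A + \sum_(i < r) w i + r%:R * mu].
Proof.
have [A [Q [[sHA sA] sQ AQM spA IHv]]] := charging_invariant (leqnn r).
have AM : A \in M by case: matM => _ sM _; apply: sM AQM; apply: subsetUl.
exists A; split=> //.
have mQ e : e \in Q -> marginal f [set e] (S r) <= mu.
  move=> eQ; have erest := subsetP sQ _ eQ.
  have eS : e \notin S r.
    by apply/negP => eS; move/disjoint_setI0/setP/(_ e): drestS; rewrite !inE erest eS.
  have eA : e \notin A.
    apply/negP => /(subsetP sA); rewrite !inE (negPf eS) orbF => eH.
    by move/disjoint_setI0/setP/(_ e): dHrest; rewrite !inE eH erest.
  have eSM : e |: S r \in M.
    apply: (@spanned_indep _ M matM A); rewrite ?S_indep //.
    by case: matM => _ sM _; apply: sM AQM; rewrite setUC setUS // sub1set.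
  (* Without an idle step [S r] would have [r] elements, and [e |: S r] would exceed the rank. *)
  have [i /eqP Ei] : exists i : 'I_r, S i.+1 == S i.
    apply/existsP; apply: contraT; rewrite negb_exists => /forallP Hn; exfalso.
    have cS i : (i <= r)%N -> #|S i| = i.
      elim: i => [|i IHi] ir; first by rewrite S0 cards0.
      case: (S_step i) => [E|[s sS ->]]; last by rewrite cardsU1 sS IHi // ltnW.
      by have := Hn (Ordinal ir); rewrite /= E eqxx.
    have := matroid_card_le eSM.
    by rewrite cardsU1 eS cS // rank_r ltnn.
  apply: le_trans (w_idle (ltn_ord i) Ei); apply: le_trans (w_rest (ltn_ord i) erest _).
    by apply: marginal1_antimono => //; apply/chain_subset/ltnW/ltn_ord.
  case: matM => _ sM _; apply: sM eSM; apply/setUS/chain_subset/ltnW/ltn_ord.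
have sumQ : \sum_(e in Q) marginal f [set e] (S r) <= r%:R * mu.
  apply: (le_trans (ler_sum _ mQ)); rewrite sumr_const -(mulr_natl mu) ler_wpM2r //.
  rewrite ler_nat -rank_r; apply: matroid_card_le => //.
  by case: matM => _ sM _; apply: sM AQM; apply: subsetUr.
have := le_sum_marginal rest (H :|: S r) sf; rewrite setUAC.
have : \sum_(e in rest) marginal f [set e] (H :|: S r) <=
       \sum_(e in rest) marginal f [set e] (S r).
  apply: ler_sum => e erest; apply: marginal1_antimono (subsetUr _ _) _ => //.
  rewrite !inE negb_or; apply/andP; split; apply/negP => eH.
    by move/disjoint_setI0/setP/(_ e): dHrest; rewrite !inE eH erest.
  by move/disjoint_setI0/setP/(_ e): drestS; rewrite !inE eH erest.
rewrite [X in _ <= X -> _](big_setID Q) /= (setIidPr sQ).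
move: IHv sumQ; lra.
Qed.

End Charging.
(** * Uniformly random permutations *)

Section Perms.
Variable n : nat.
Implicit Types (s pi : 'S_n) (e : 'I_n).

Definition fixes_below (a : nat) s := forall i : 'I_n, (i < a)%N -> s i = i.

(** In [s * pi] the factor [s] acts first, on arrival positions: the invariance says that [F]
    depends only on the first [a] arrivals. *)
Definition prefix_determined (a : nat) (T : Type) (F : 'S_n -> T) :=
  forall s pi, fixes_below a s -> F (s * pi)%g = F pi.

Lemma prefix_determined_leq (a b : nat) (T : Type) (F : 'S_n -> T) :
  (a <= b)%N -> prefix_determined a F -> prefix_determined b F.
Proof.
move=> ab dF s pi fs; apply: dF => i ia; apply: fs; exact: leq_trans ab.
Qed.

Lemma fixes_below_tperm (a : nat) (i j : 'I_n) :
  (a <= i)%N -> (a <= j)%N -> fixes_below a (tperm i j).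
Proof.
move=> ai aj k ka; rewrite tpermD //; apply/eqP => E; move: ka; rewrite -E ltnNge ?ai ?aj //.
Qed.

(** Swapping positions [t] and [j >= t] changes neither [A] nor [B], so each of the [n - t] late
    positions contributes the same count. *)
Lemma card_next_in (A : pred 'S_n) (B : 'S_n -> {set 'I_n}) (t : 'I_n) :
  prefix_determined t A -> prefix_determined t B ->
  (forall pi i, pi i \in B pi -> (t <= i)%N) ->
  (\sum_(pi | A pi) #|B pi| = (n - t) * #|[set pi | A pi & pi t \in B pi]|)%N.
Proof.
move=> dA dB B_late.
have cB pi : #|B pi| = (\sum_(j < n | (t <= j)%N) (pi j \in B pi))%N.
  rewrite -(card_preimset (B pi) (@perm_inj _ pi)) -sum1_card big_mkcond /= [RHS]big_mkcond /=.
  apply: eq_bigr => j _; rewrite inE; case: ifP => [/B_late -> //|_].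
  by rewrite if_same.
under eq_bigr do rewrite cB.
rewrite exchange_big /=.
transitivity (\sum_(j < n | (t <= j)%N) #|[set pi | A pi & pi t \in B pi]|)%N; last first.
  by rewrite -sum_nat_const_nat big_geq_mkord.
apply: eq_bigr => j tj.
rewrite -sum1_card big_mkcond (reindex_inj (mulgI (tperm t j))) /= [RHS]big_mkcond /=.
apply: eq_bigr => pi _; rewrite !inE.
rewrite dA ?dB; do ?exact: fixes_below_tperm.
by rewrite permM tpermR; case: (A pi).
Qed.

(** As long as no arrival has hit [B], all of [B] is still to come, so the next arrival hits with
    conditional probability at least [k / n]. *)
Lemma card_window_avoid (A : pred 'S_n) (B : 'S_n -> {set 'I_n}) (a W k : nat) :
  prefix_determined a A -> prefix_determined a B ->
  (forall pi i, pi i \in B pi -> (a <= i)%N) ->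
  (forall pi, A pi -> (k <= #|B pi|)%N) -> (a + W <= n)%N ->
  (#|[set pi | A pi & [forall i : 'I_n, (a <= i < a + W)%N ==> (pi i \notin B pi)]]|
     * n ^ W <= #|[set pi | A pi]| * (n - k) ^ W)%N.
Proof.
move=> dA dB lB kB; elim: W => [_|W IH].
  rewrite !expn0 !muln1; apply: subset_leq_card; apply/subsetP => pi.
  by rewrite !inE => /andP[].
rewrite addnS => aWn; have {}IH := IH (ltnW aWn).
pose t : 'I_n := Ordinal aWn.
pose AW pi := A pi && [forall i : 'I_n, (a <= i < a + W)%N ==> (pi i \notin B pi)].
have dAW : prefix_determined t AW.
  move=> s pi fs; have fsa : fixes_below a s.
    by move=> i ia; apply: fs; apply: leq_trans (leq_addr _ _).
  rewrite /AW dA // dB //; congr (_ && _); apply: eq_forallb => i.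
  case: (boolP (a <= i < a + W)%N) => //= /andP[_ iW].
  by rewrite permM fs.
(* Emptying [B] outside [AW] ensures that its elements always arrive at position [t] or later, as
   [card_next_in] asks. *)
pose B' pi := if AW pi then B pi else set0.
have dB' : prefix_determined t B'.
  by move=> s pi fs; rewrite /B' dAW // (prefix_determined_leq (leq_addr W a) dB pi fs).
have lB' pi i : pi i \in B' pi -> (t <= i)%N.
  rewrite /B'; case: ifP => [/andP[_ /forallP/(_ i)]|]; last by rewrite inE.
  move=> H piB; move: H; rewrite piB implybF (lB _ _ piB) /= -leqNgt.
  by [].
have := card_next_in dAW dB' lB'.
set hit := [set pi | AW pi & _].
set miss := [set pi | _ & _].
move=> E; have cAW : #|[set pi | AW pi]| = (#|hit| + #|miss|)%N.
  rewrite -(cardsID hit); congr (_ + _)%N; apply: eq_card => pi; rewrite !inE /B'.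
    by case: (AW pi).
  rewrite -[in RHS]/(A pi && _).
  have -> : [forall i : 'I_n, (a <= i < (a + W).+1)%N ==> (pi i \notin B pi)] =
     [forall i : 'I_n, (a <= i < a + W)%N ==> (pi i \notin B pi)] && (pi t \notin B pi).
    apply/forallP/andP => [H|[/forallP H Ht] i].
      split; last by have := H t; rewrite /= leq_addr ltnSn.
      apply/forallP=> i; apply/implyP => /andP[ai iW].
      by have := H i; rewrite ai ltnS (ltnW iW).
    apply/implyP => /andP[ai]; rewrite ltnS leq_eqVlt => /orP[/eqP iE|iW].
      by suff -> : i = t by []; apply: val_inj.
    by have := H i; rewrite ai iW.
  rewrite /AW; case: (A pi) => //=; case: [forall _, _] => //=; rewrite ?andbT ?andbF //.
have leS : (k * #|[set pi | AW pi]| <= n * #|hit|)%N.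
  apply: (@leq_trans ((n - t) * #|hit|)%N); last by rewrite leq_mul2r leq_subr orbT.
  rewrite -E mulnC -sum_nat_const (eq_bigl AW) => [|pi]; last by rewrite inE.
  by apply: leq_sum => pi AWpi; rewrite /B' AWpi; apply: kB; case/andP: AWpi.
have step : (#|miss| * n <= #|[set pi | AW pi]| * (n - k))%N by nia.
have {}IH : (#|[set pi | AW pi]| * n ^ W <= #|[set pi | A pi]| * (n - k) ^ W)%N := IH.
rewrite !expnSr; apply: leq_trans (leq_trans _ (leq_mul IH (leqnn (n - k)%N))) _; last first.
- by rewrite mulnA.
- by rewrite mulnC -mulnA [X in (_ <= X)%N]mulnAC [X in (_ <= X)%N]mulnC leq_mul2l
    [X in (X <= _)%N]mulnC step orbT.
Qed.

Lemma card_perm_eq (j e : 'I_n) : (n * #|[set pi : 'S_n | pi j == e]| = n`!)%N.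
Proof.
transitivity (\sum_(i < n) #|[set pi : 'S_n | pi i == e]|)%N.
  rewrite [RHS](eq_bigr (fun=> #|[set pi : 'S_n | pi j == e]|)) => [|i _].
    by rewrite sum_nat_const card_ord.
  rewrite -!sum1_card big_mkcond (reindex_inj (mulgI (tperm i j))) /= [RHS]big_mkcond.
  by apply: eq_bigr => pi _; rewrite !inE permM tpermL.
under eq_bigr do rewrite -sum1_card big_set /= big_mkcond /=.
rewrite exchange_big /= -card_Sn -cardsT -sum1_card big_set; apply: eq_bigr => pi _.
rewrite -[LHS]/(\sum_(i < n) (if pi i == e then 1 else 0))%N (bigD1 ((pi^-1)%g e)) //=.
rewrite permKV eqxx big1 ?addn0 // => i ie.
by case: eqP => // E; rewrite -E permK eqxx in ie.
Qed.

Lemma card_perm_early (L : nat) (e : 'I_n) : (L <= n)%N ->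
  (n * #|[set pi : 'S_n | ((pi^-1)%g e < L)%N]| = L * n`!)%N.
Proof.
move=> Ln; have -> : #|[set pi : 'S_n | ((pi^-1)%g e < L)%N]| =
   (\sum_(j < n | (j < L)%N) #|[set pi : 'S_n | pi j == e]|)%N.
  under [RHS]eq_bigr do rewrite -sum1_card big_set /= big_mkcond /=.
  rewrite exchange_big /= -sum1_card big_set big_mkcond /=; apply: eq_bigr => pi _.
  rewrite -[LHS]/(if ((pi^-1)%g e < L)%N then 1 else 0)%N.
  rewrite -[RHS]/(\sum_(j < n | (j < L)%N) (if pi j == e then 1 else 0))%N -big_mkcondr /=.
  case: ifP => lt.
    rewrite (bigD1 ((pi^-1)%g e)) /= ?lt ?permKV //= big1 // => j /andP[/andP[_ /eqP E]].
    by rewrite -E permK eqxx.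
  rewrite big1 // => j /andP[jL /eqP E]; move: lt; rewrite -E permK jL //.
rewrite big_distrr /=; under eq_bigr do rewrite card_perm_eq.
by rewrite -(big_ord_widen n (fun=> n`!) Ln) sum_nat_const card_ord.
Qed.

End Perms.
(** * Estimates on rounding, logarithms and top elements *)

Section Numeric.
Variable R : realType.
Implicit Types (x y eps : R) (I : seq R).

Lemma ceil_nat_ge x : x <= (ceil_nat x)%:R.
Proof.
apply: le_trans (ceil_ge x) _; rewrite /ceil_nat.
by rewrite -[_%:R]/(_%:Z%:~R) ler_int abszE ler_norm.
Qed.

Lemma ceil_nat_lt x : 0 <= x -> (ceil_nat x)%:R < x + 1.
Proof.
move=> x0; have c0 : 0 <= Num.ceil x by rewrite ceil_ge0; lra.
rewrite /ceil_nat -[_%:R]/(_%:Z%:~R) gez0_abs //.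
by have /andP[+ _] := ceil_itv x; rewrite intrD; lra.
Qed.

(** [1 - k / n] is at most [expR (- (k / n))], whose [W]-th power is at most [y]. *)
Lemma expR_decay (N c n k W : nat) y : 0 < y -> (0 < n)%N -> (k <= n)%N ->
  ln y^-1 * n%:R <= (k * W)%:R -> (c * n ^ W <= N * (n - k) ^ W)%N ->
  c%:R <= N%:R * y.
Proof.
move=> y0 n0 kn lnle le.
have n0' : 0 < n%:R :> R by rewrite ltr0n.
have nW : 0 < n%:R ^+ W :> R by rewrite exprn_gt0.
have {}le : c%:R * n%:R ^+ W <= N%:R * (n - k)%:R ^+ W :> R.
  by rewrite -!natrX -!natrM ler_nat.
rewrite -(ler_pM2r nW); apply: le_trans le _; rewrite -mulrA ler_wpM2l //.
have le1 : (n - k)%:R <= n%:R * expR (- (k%:R / n%:R)) :> R.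
  have := expR_ge1Dx (- (k%:R / n%:R) : R); rewrite -(ler_pM2l n0').
  by rewrite mulrDr mulr1 mulrN mulrCA divff ?gt_eqF // mulr1 natrB.
apply: (@le_trans _ _ ((n%:R * expR (- (k%:R / n%:R))) ^+ W)).
  by apply: lerXn2r; rewrite ?nnegrE ?ler0n ?mulr_ge0 ?expR_ge0.
rewrite exprMn mulrC (ler_wpM2r (ltW nW)) -?expRM_natl //.
have -> : y = expR (ln y) by rewrite lnK.
rewrite ler_expR.
rewrite lnV // in lnle; rewrite mulrN lerNl mulrA ler_pdivlMr //.
by rewrite -natrM mulnC.
Qed.

Lemma rounding_ge I x i : i \in I -> i <= x -> i <= rounding I x.
Proof. by move=> iI ix; apply: (@le_bigmax_seq _ _ _ _ _ i (fun j => j <= x) id). Qed.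

Lemma seq_min_le I i : i \in I -> seq_min I <= i.
Proof. by move=> iI; apply: (@ge_bigmin_seq _ _ _ _ _ i xpredT id). Qed.

Lemma rounding_le I x : rounding I x <= Num.max x (seq_min I).
Proof.
by apply: bigmax_le => [|i ix]; rewrite le_max ?lexx ?ix ?orbT.
Qed.

Lemma rounding_mono I x y : x <= y -> rounding I x <= rounding I y.
Proof.
by move=> xy; apply: sub_bigmax => i ix; apply: le_trans xy.
Qed.

Lemma seq_min_in I : I != [::] -> seq_min I \in I.
Proof.
case: I => // a I _; rewrite /seq_min /=; set s := a :: I.
rewrite big_seq; elim/big_ind: _ => //; first exact: mem_head.
by move=> u v us vs; rewrite /Num.min; case: ifP.
Qed.

Lemma rounding_in I x : I != [::] -> rounding I x \in I.
Proof.
move=> I0; rewrite /rounding big_seq_cond; elim/big_ind: _ => //.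
- exact: seq_min_in.
- by move=> u v us vs; rewrite /Num.max; case: ifP.
- by move=> i /andP[].
Qed.

(** If [x >= c], some grid point [g <= x] has [x <= (1 + eps) * g], and [g] is at most the rounding
    of [y]. Values under the grid are rounded up to [c], hence the maximum. *)
Lemma geometric_rounding eps (c : R) (K : nat) x y :
  0 <= eps -> 0 <= c -> x <= (1 + eps) ^+ K * c ->
  let I := [seq (1 + eps) ^+ k * c | k <- iota 0 K.+1] in
  rounding I x <= rounding I y ->
  x <= (1 + eps) * Num.max y c.
Proof.
move=> e0 c0 xK I le.
have cI : c \in I by apply/mapP; exists 0%N; rewrite ?mem_iota // expr0 mul1r.
have max0 : 0 <= Num.max y c by rewrite le_max c0 orbT.
have [xc|cx] := ltP x c.
  apply: (@le_trans _ _ (Num.max y c)); first by rewrite le_max (ltW xc) orbT.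
  by rewrite ler_peMl //; lra.
have [k kK /andP[kx xk]] : exists2 k, (k <= K)%N &
    (1 + eps) ^+ k * c <= x <= (1 + eps) * ((1 + eps) ^+ k * c).
  elim: K xK {I le cI} => [|K IH] xK.
    exists 0%N => //; rewrite expr0 mul1r cx /=; move: xK; rewrite expr0 mul1r.
    by move=> /le_trans; apply; rewrite ler_peMl //; lra.
  have [/IH[k kK H]|/ltW lt] := leP x ((1 + eps) ^+ K * c); first by exists k => //; apply: leqW.
  by exists K => //; rewrite lt mulrA -exprS.
apply: (le_trans xk); rewrite ler_wpM2l //; first by lra.
have kI : (1 + eps) ^+ k * c \in I by apply/mapP; exists k; rewrite ?mem_iota.
apply: le_trans (rounding_ge kI kx) _; apply: (le_trans le).
apply: le_trans (rounding_le _ _) _.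
by rewrite ge_max !le_max lexx (seq_min_le cI) orbT.
Qed.

Lemma ln1D_ge x : 0 <= x -> x / (1 + x) <= ln (1 + x).
Proof.
move=> x0; have x1 : 0 < 1 + x by lra.
have : ln (1 + x)^-1 <= (1 + x)^-1 - 1.
  have := @le_ln1Dx R ((1 + x)^-1 - 1); rewrite addrCA subrr addr0; apply.
  by rewrite ltrBDr addrC subrr invr_gt0.
rewrite lnV //; have -> : (1 + x)^-1 - 1 = - (x / (1 + x)) by field; lra.
by rewrite lerN2.
Qed.

End Numeric.

(** * Top elements and first maximisers *)

Section Top.
Variables (R : realType) (n : nat).
Implicit Types (U : {set 'I_n}) (g : 'I_n -> R).

(* Ties are kept, so that there are at least [k] elements as soon as #|U| >= k. *)
Definition top_set U g (k : nat) : {set 'I_n} :=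
  [set b in U | (#|[set e in U | (g b < g e)%R]| < k)%N].

(** For a best element [b] among those left out, the at least [k] elements strictly above [b] all
    belong to the top set. *)
Lemma card_top_set U g k : (k <= #|U|)%N -> (k <= #|top_set U g k|)%N.
Proof.
move=> kU; have [E|[b0 b0U]] := set_0Vmem (U :\: top_set U g k).
  apply: leq_trans kU _; apply: subset_leq_card; rewrite -setD_eq0; exact/eqP.
have [b bU maxb] := @arg_maxP _ _ _ b0 [in U :\: top_set U g k] g b0U.
move: bU; rewrite !inE => /andP[+ bU]; rewrite bU -leqNgt => kb.
apply: leq_trans kb _; apply: subset_leq_card; apply/subsetP => e.
rewrite !inE => /andP[eU lt]; rewrite eU /= ltnNge; apply/negP => ke.
have := maxb e; rewrite /= !inE eU andbT -leqNgt => /(_ ke) /(lt_le_trans lt).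
by rewrite ltxx.
Qed.

Lemma sorted_take_ge (T : eqType) (leT : rel T) (s : seq T) K x y :
  transitive leT -> sorted leT s -> x \in take K s -> y \in drop K s -> leT x y.
Proof.
move=> tr; rewrite (sorted_pairwise tr) -{1}(cat_take_drop K s) pairwise_cat.
by case/and3P => /allrelP H _ _ xs ys; apply: H.
Qed.

Lemma ohead_filter_mem (T : eqType) (P : pred T) s x :
  ohead (filter P s) = Some x -> P x /\ x \in s.
Proof.
move=> E; have : x \in filter P s.
  by case: (filter P s) E => //= a l [->]; rewrite mem_head.
by rewrite mem_filter => /andP[].
Qed.

Lemma first_argmaxP (T : eqType) (g : T -> R) s x :
  first_argmax g s = Some x -> x \in s /\ {in s, forall y, g y <= g x}.
Proof. by case/ohead_filter_mem => /allP. Qed.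

Lemma first_argmax_None (T : eqType) (g : T -> R) s : first_argmax g s = None -> s = [::].
Proof.
case: s => // a s E; exfalso.
have [x xs maxx] : exists2 x, x \in a :: s & {in a :: s, forall y, g y <= g x}.
  elim: s {E} a => [|b s IH] a.
    by exists a; rewrite ?mem_head // => y; rewrite inE => /eqP ->.
  have [x xs maxx] := IH b; have [ax|/ltW xa] := leP (g a) (g x).
    exists x; first by rewrite inE xs orbT.
    by move=> y; rewrite inE => /orP[/eqP ->|/maxx].
  exists a; first exact: mem_head.
  by move=> y; rewrite inE => /orP[/eqP ->|/maxx /le_trans ->].
move: E; rewrite /first_argmax.
have : x \in [seq z <- a :: s | all (fun y => g y <= g z) (a :: s)].
  by rewrite mem_filter xs andbT; apply/allP.
by case: [seq _ <- _ | _].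
Qed.

(** Ties favour earlier elements, so an existing maximiser is replaced only by a strictly better
    one. This lets a running maximiser be kept in memory. *)
Lemma first_argmax_rcons (T : eqType) (g : T -> R) s x :
  first_argmax g (rcons s x) = first_argmax g s \/ first_argmax g (rcons s x) = Some x.
Proof.
case Es : (first_argmax g s) => [y|]; last first.
  by right; rewrite (first_argmax_None Es) /first_argmax /= lexx.
have [ys maxy] := first_argmaxP Es.
have [xy|yx] := leP (g x) (g y); [left|right].
  rewrite -Es /first_argmax filter_rcons all_rcons.
  have -> : [seq z <- s | all (fun y0 => g y0 <= g z) (rcons s x)] =
            [seq z <- s | all (fun y0 => g y0 <= g z) s].
    apply: eq_in_filter => z zs; rewrite all_rcons.
    case: (boolP (all _ s)) => [/allP/(_ _ ys) yz|]; rewrite ?andbF //=.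
    by rewrite (le_trans xy yz).
  have : y \in [seq z <- s | all (fun y0 => g y0 <= g z) s].
    by rewrite mem_filter ys andbT; apply/allP.
  by case: [seq _ <- s | _] => // a l _; case: ifP.
rewrite /first_argmax filter_rcons all_rcons lexx /=.
have -> : all (fun y0 => g y0 <= g x) s.
  by apply/allP => z /maxy /le_trans; apply; apply: ltW.
rewrite (_ : [seq _ <- s | _] = [::]) //.
apply/eqP; rewrite -[_ == _]negbK -has_filter; apply/hasPn => z zs.
by rewrite all_rcons negb_and -ltNge (le_lt_trans (maxy _ zs) yx).
Qed.

End Top.
(** * Dependence on the prefix of the stream *)

Lemma take_drop_take (T : Type) (w a t : nat) (s : seq T) : (a + w <= t)%N ->
  take w (drop a (take t s)) = take w (drop a s).
Proof. by move=> le; rewrite !take_drop take_takel // addnC. Qed.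

Section Algorithm.
Variables (R : realType) (n : nat) (f : {set 'I_n} -> R) (M : {set {set 'I_n}}).
Variables (r : nat) (eps : R).
Implicit Types (p q : seq 'I_n) (e x : 'I_n).

Local Notation P := (@phase1_len R n eps).
Local Notation W := (@window_len R n r eps).
Local Notation S p i := (gf_S f M r eps p i).
Local Notation sel p i X := (gf_select f M r eps p i X).

Lemma gf_V_take p t i : (0 < i)%N -> (P + i * W <= t)%N ->
  gf_V r eps (take t p) i = gf_V r eps p i.
Proof.
case: i => // i _ le; rewrite /gf_V take_drop_take //=.
by rewrite -addnA -mulSnr.
Qed.

Lemma gf_s1_take p t : (P + W <= t)%N -> gf_s1 f M r eps (take t p) = gf_s1 f M r eps p.
Proof. by move=> le; rewrite /gf_s1 gf_V_take // mul1n. Qed.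

Lemma gf_select_take p t i X : (0 < i)%N -> (P + i * W <= t)%N ->
  sel (take t p) i X = sel p i X.
Proof.
move=> i0 le; have leW : (P + W <= t)%N.
  by apply: leq_trans le; rewrite leq_add2l leq_pmull.
by rewrite /gf_select gf_s1_take // gf_V_take.
Qed.

(** Used both to show that a greedy set is frozen after its window and to condition on the past in
    the probability estimates. *)
Lemma gf_S_take p t i : (P + i * W <= t)%N -> S (take t p) i = S p i.
Proof.
elim: i => //= i IH le; rewrite IH.
  by rewrite gf_select_take.
by apply: leq_trans le; rewrite leq_add2l leq_mul2r leqnSn orbT.
Qed.

Lemma gf_s_take p t i : (0 < i)%N -> (P + i * W <= t)%N ->
  gf_s f M r eps (take t p) i = gf_s f M r eps p i.
Proof.
case: i => // i _ le; rewrite /gf_s /= gf_S_take ?gf_select_take //.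
by apply: leq_trans le; rewrite leq_add2l leq_mul2r leqnSn orbT.
Qed.

Lemma gf_w_take p t : (P <= t)%N -> gf_w f M r eps (take t p) = gf_w f M r eps p.
Proof. by move=> le; rewrite /gf_w /gf_V0 take_takel. Qed.

Lemma gf_I_take p t : (P <= t)%N -> gf_I f M r eps (take t p) = gf_I f M r eps p.
Proof. by move=> le; rewrite /gf_I gf_w_take. Qed.

Lemma gf_step_take p t H e : (P + r * W <= t)%N ->
  gf_step f M r eps (take t p) H e = gf_step f M r eps p H e.
Proof.
move=> le; have leP : (P <= t)%N by apply: leq_trans le; apply: leq_addr.
rewrite /gf_step /gf_cap /card_I gf_I_take //.
suff -> : gf_accept f M r eps (take t p) e = gf_accept f M r eps p e by [].
rewrite /gf_accept gf_I_take //; apply: eq_existsb => i.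
have lei : (P + i.+1 * W <= t)%N.
  by apply: leq_trans le; rewrite leq_add2l leq_mul2r ltn_ord orbT.
rewrite gf_s_take // gf_S_take //.
by apply: leq_trans lei; rewrite leq_add2l leq_mul2r leqnSn orbT.
Qed.

Lemma gf_V_nil q i : (size q <= P + i.-1 * W)%N -> gf_V r eps q i = [::].
Proof. by move=> le; rewrite /gf_V drop_oversize. Qed.

Lemma gf_s1_sub q : set_of_option (gf_s1 f M r eps q) \subset S q 1.
Proof. by rewrite /= set0U. Qed.

Lemma set_of_optionE (T : finType) (o : option T) :
  set_of_option o = if o is Some s then [set s] else set0.
Proof.
by case: o => [s|]; apply/setP => x; rewrite !inE // eq_sym.
Qed.

Lemma gf_S_step q i :
  S q i.+1 = S q i \/ exists2 s, s \notin S q i & S q i.+1 = s |: S q i.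
Proof.
rewrite /= set_of_optionE; case: (sel q i.+1 _) => [s|]; last by left; rewrite setU0.
have [sS|sS] := boolP (s \in S q i); last by right; exists s; rewrite // setUC.
by left; apply/setUidPl; rewrite sub1set.
Qed.

Lemma gf_S_mono q i j : (i <= j)%N -> S q i \subset S q j.
Proof. by apply: chain_subset; apply: gf_S_step. Qed.

Lemma gf_S_idle q i : (size q <= P + i * W)%N -> S q i.+1 = S q i.
Proof.
move=> le; have V0 := @gf_V_nil q i.+1 le; case: i => [|i] in le V0 *.
  rewrite /= /gf_select /gf_s1 eqxx V0 /=.
  by apply/setP => x; rewrite !inE.
have sub1 := subset_trans (gf_s1_sub q) (gf_S_mono q (ltn0Sn i)).
rewrite -[LHS]/(S q i.+1 :|: set_of_option (sel q i.+2 (S q i.+1))).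
apply/setUidPl; move: (S q i.+1) sub1 => X.
rewrite /gf_select eqSS V0 cats0 /first_argmax.
case: (gf_s1 f M r eps q) => [s|] /=; rewrite !set_of_optionE ?sub0set // => sX.
by case: ifP => _; rewrite /= ?lexx ?sub0set.
Qed.

Lemma set_of_option_sub (o o' : option 'I_n) x X : (o = o' \/ o = Some x) ->
  X :|: set_of_option o \subset x |: (X :|: set_of_option o').
Proof.
move=> H; apply/subsetP => y; rewrite !inE => /orP[->|]; first by rewrite orbT.
by case: H => -> => [->|/eqP[->]]; rewrite ?eqxx ?orbT.
Qed.

(** After window [i.+1] the set is frozen, and before it the step is idle. While the window is open,
    the previous set is frozen and the running maximiser can only change to [x]. *)
Lemma gf_S_rcons q x i : S (rcons q x) i \subset x |: S q i.
Proof.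
elim: i => [|i IH]; first by rewrite /= sub0set.
have takeq : take (size q) (rcons q x) = q by rewrite -cats1 take_size_cat.
have [le|lt] := leqP (P + i.+1 * W) (size q).
  by rewrite -(gf_S_take (rcons q x) le) takeq subsetUr.
have [lt'|le] := ltnP (size q) (P + i * W).
  by rewrite !gf_S_idle // ?size_rcons // ltnW.
rewrite /= -(gf_S_take (rcons q x) le) takeq; apply: set_of_option_sub.
have VE : gf_V r eps (rcons q x) i.+1 = rcons (gf_V r eps q i.+1) x.
  rewrite /gf_V /= drop_rcons // take_oversize.
    by rewrite take_oversize // size_drop leq_subLR -addnA -mulSnr ltnW.
  by rewrite size_rcons size_drop -subSn // leq_subLR -addnA -mulSnr.
case: i IH VE le lt => [|i] IH VE le lt.
  rewrite /gf_select eqxx /gf_s1 VE filter_rcons.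
  by case: ifP => _; [apply: first_argmax_rcons | left].
have leW : (P + W <= size q)%N by apply: leq_trans le; rewrite leq_add2l leq_pmull.
rewrite /gf_select eqSS /= VE -(gf_s1_take (rcons q x) leW) takeq -rcons_cat filter_rcons.
by case: ifP => _; [apply: first_argmax_rcons | left].
Qed.

Lemma mem_take_filter (T : eqType) (a : pred T) K (s : seq T) y :
  y \in take K s -> a y -> y \in take K (filter a s).
Proof.
move=> ys ay; rewrite -(cat_take_drop K s) filter_cat take_cat.
have yf : y \in filter a (take K s) by rewrite mem_filter ay.
have le : (size (filter a (take K s)) <= K)%N.
  by rewrite size_filter (leq_trans (count_size _ _)) // size_take_min geq_minl.
by case: ltnP => [lt|_]; [rewrite ltnNge le in lt | rewrite mem_cat yf].
Qed.

(** A stable sort commutes with filtering: removing [x] from the sorted list yields the old sorted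
    list, with no other element moved back. *)
Lemma gf_T_rcons q x : x \notin q -> gf_T f M eps (rcons q x) \subset x |: gf_T f M eps q.
Proof.
move=> xq; apply/subsetP => y; rewrite !inE /gf_T.
set leT := fun _ _ => _; case: eqP => //= /eqP yx.
move=> ys; have := @mem_take_filter _ (predC1 x) _ _ _ ys yx.
have leT_tr : transitive leT by move=> a b c /[swap]; apply: le_trans.
have leT_tot : total leT by move=> a b; apply: le_total.
rewrite filter_sort // -filter_predI filter_rcons /= eqxx /=.
rewrite (@eq_in_filter _ _ (fun e => [set e] \in M)) // => z zq /=; rewrite andbC.
by case: eqP => [zx|_]; [rewrite zx (negPf xq) in zq | rewrite andbT].
Qed.

Lemma gf_H_rcons q x : gf_H f M r eps (rcons q x) \subset x |: gf_H f M r eps q.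
Proof.
have takeq : take (size q) (rcons q x) = q by rewrite -cats1 take_size_cat.
rewrite /gf_H; have [lt|le] := ltnP (size q) (P + r * W).
  by rewrite drop_oversize ?size_rcons // sub0set.
rewrite drop_rcons // foldl_rcons.
have E s H : foldl (gf_step f M r eps (rcons q x)) H s = foldl (gf_step f M r eps q) H s.
  elim: s H => //= a s IH H; rewrite -(gf_step_take (rcons q x) H a le) takeq; exact: IH.
rewrite E -(gf_step_take (rcons q x) _ x le) takeq /gf_step.
by case: ifP => _; [apply: subsetUr | case: ifP => _ //; apply: subsetUr].
Qed.

Lemma gf_stored_rcons q x : x \notin q ->
  gf_stored f M r eps (rcons q x) \subset x |: gf_stored f M r eps q.
Proof.
move=> xq; rewrite /gf_stored setUUr [_ :|: (gf_T _ _ _ _ :|: _)]setUUr.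
apply: setUSS (gf_H_rcons q x).
by apply: setUSS (gf_S_rcons q x r); apply: gf_T_rcons.
Qed.

Lemma gf_stored_nil : gf_stored f M r eps [::] = set0.
Proof.
have SN i : S [::] i = set0 by elim: i => //= i <-; apply: (@gf_S_idle [::] i).
rewrite /gf_stored SN /gf_H /gf_T /=; by apply/setP => x; rewrite !inE.
Qed.

Lemma card_gf_T p : (#|gf_T f M eps p| <= top_size eps)%N.
Proof.
rewrite /gf_T cardsE; apply: leq_trans (card_size _) _.
by rewrite size_take_min geq_minl.
Qed.

Lemma card_gf_S p i : (#|S p i| <= i)%N.
Proof.
elim: i => [|i IH]; first by rewrite cards0.
rewrite /= cardsU; apply: leq_trans (leq_subr _ _) _; rewrite -[i.+1]addn1; apply: leq_add => //.
by rewrite set_of_optionE; case: (gf_select _ _ _ _ _ _ _) => [s|]; rewrite ?cards1 ?cards0.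
Qed.

Lemma card_gf_H p : 0 <= gf_cap f M r eps p -> #|gf_H f M r eps p|%:R <= gf_cap f M r eps p + 1.
Proof.
move=> cap0; rewrite /gf_H; set s := drop _ _.
suff H0 (H : {set 'I_n}) : #|H|%:R <= gf_cap f M r eps p + 1 ->
    #|foldl (gf_step f M r eps p) H s|%:R <= gf_cap f M r eps p + 1.
  by apply: H0; rewrite cards0; lra.
elim: s H => //= e s IH H leH; apply: IH; rewrite /gf_step.
case: ltP => // leH'; case: ifP => // _.
rewrite cardsU1; apply: le_trans (_ : 1 + #|H|%:R <= _); last by lra.
by rewrite natrD lerD2r; case: (_ \notin _); rewrite /= ?lexx // ler01.
Qed.

End Algorithm.

(** * Streams on which no window misses *)

Lemma card_bigcup_le (T I : finType) (Q : pred I) (F : I -> {set T}) :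
  (#|\bigcup_(i | Q i) F i| <= \sum_(i | Q i) #|F i|)%N.
Proof.
elim/big_rec2: _ => [|i s A _ IH]; first by rewrite cards0.
by rewrite cardsU (leq_trans (leq_subr _ _)) // leq_add2l.
Qed.

Section GoodStream.
Variables (R : realType) (n : nat) (f : {set 'I_n} -> R) (M : {set {set 'I_n}}).
Variables (r : nat) (eps : R).
Hypothesis f_ge0 : forall X, 0 <= f X.
Hypothesis sf : lattice_submodular f.
Hypothesis matM : matroid M.
Hypothesis r0 : (0 < r)%N.
Hypothesis eps_bounds : 0 < eps < 2^-1.
Implicit Types (p q : seq 'I_n) (e x : 'I_n).

Local Notation P := (@phase1_len R n eps).
Local Notation W := (@window_len R n r eps).
Local Notation S p i := (gf_S f M r eps p i).
Local Notation I p := (gf_I f M r eps p).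

(* Indices are shifted: [gain p i] is the marginal value of s_{i+1}. *)
Definition gain p i : R := f (S p i.+1) - f (S p i).
Definition accepts p i e : bool :=
  (e |: S p i \in M) &&
  (rounding (I p) (gain p i) < rounding (I p) (marginal f [set e] (S p i))).
Definition late p : seq 'I_n := drop (P + r * W) p.
Definition phase1_max p : R := \big[Num.max/0]_(e <- gf_V0 eps p | [set e] \in M) f [set e].

Lemma subset_indep (X Y : {set 'I_n}) : X \subset Y -> Y \in M -> X \in M.
Proof. by case: matM => _ sM _; apply: sM. Qed.

Lemma gf_acceptE p e : gf_accept f M r eps p e = [exists i : 'I_r, accepts p i e].
Proof.
apply: eq_existsb => i; rewrite /accepts; congr (_ && (rounding _ _ < _)).
by rewrite /marginal /gain /gf_s setUC.
Qed.

(** The first selection compares singletons without looking at [X], hence the condition for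
    [i = 1]. *)
Lemma gf_select_in p i X s : gf_select f M r eps p i X = Some s ->
  (i == 1%N -> X = set0) -> s \in p /\ s |: X \in M.
Proof.
have s1P e : gf_s1 f M r eps p = Some e -> e \in p /\ [set e] \in M.
  case/first_argmaxP; rewrite mem_filter => /andP[eM /mem_take/mem_drop ep] _.
  by [].
rewrite /gf_select; case: eqP => [_ /s1P[sp sM] /(_ isT) ->|_]; first by rewrite setU0.
case/first_argmaxP; rewrite mem_filter mem_cat => /andP[-> +] _ _.
case/orP; last by move/mem_take/mem_drop.
by case E: (gf_s1 f M r eps p) => [e|] //; rewrite inE => /eqP ->; case: (s1P e E).
Qed.

Lemma gf_S_in p i x : x \in S p i -> x \in p.
Proof.
elim: i => [|i IH]; first by rewrite inE.
rewrite [S p i.+1]/(S p i :|: set_of_option (gf_select f M r eps p i.+1 (S p i))) !inE.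
case/orP => [/IH //|/eqP/gf_select_in[]] //.
by case: i {IH}.
Qed.

Lemma gf_S_early p i x : (i <= r)%N -> x \in S p i -> x \in take (P + r * W) p.
Proof.
move=> ir; rewrite -(@gf_S_take _ _ f M r eps p (P + r * W)) ?leq_add2l ?leq_mul2r ?ir ?orbT //.
exact: gf_S_in.
Qed.

Lemma setU_option_indep (X : {set 'I_n}) o :
  X \in M -> (forall s, o = Some s -> s |: X \in M) -> X :|: set_of_option o \in M.
Proof.
move=> XM; rewrite set_of_optionE setUC.
by case: o => [s|] oM; [apply: oM | rewrite set0U].
Qed.

Lemma gf_S_indep p i : S p i \in M.
Proof.
elim: i => [|i IH]; first exact: matroid_set0.
by apply: setU_option_indep => // s /gf_select_in[] // /eqP[->].
Qed.

Lemma late_notin_S p i e : uniq p -> (i <= r)%N -> e \in late p -> e \notin S p i.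
Proof.
move=> up ir el; apply/negP => /(gf_S_early ir) ee.
move: up; rewrite -(cat_take_drop (P + r * W) p) cat_uniq => /and3P[_ /hasPn/(_ _ el)].
by rewrite /= ee.
Qed.

Lemma gf_I_neq0 p : I p != [::].
Proof. by []. Qed.

(* If [e] beats [s_i] at some level, it also beats the first [s_j] of the same
   level, by submodularity.  So there are at most [card_I] relevant indices. *)
Lemma card_accepted p (k : R) : uniq p -> 0 <= k ->
  (forall i, (i < r)%N -> #|[set e in late p | accepts p i e]|%:R <= k) ->
  #|[set e in late p | gf_accept f M r eps p e]|%:R <= (card_I f M r eps p)%:R * k.
Proof.
move=> up k0 Hk.
pose lev (i : 'I_r) := rounding (I p) (gain p i).
pose First := [set i : 'I_r | [forall j : 'I_r, (lev j == lev i) ==> (i <= j)%N]].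
pose Acc (i : 'I_r) := [set e in late p | accepts p i e].
have cF : (#|First| <= card_I f M r eps p)%N.
  rewrite /card_I cardE -(size_map lev); apply: uniq_leq_size.
    rewrite map_inj_in_uniq ?enum_uniq // => i j; rewrite !mem_enum !inE.
    move=> /forallP/(_ j)/implyP ij /forallP/(_ i)/implyP ji E.
    by apply/val_inj/eqP; rewrite /= eqn_leq ij ?ji ?E.
  move=> y /mapP[i _ ->]; rewrite mem_undup.
  exact/rounding_in/gf_I_neq0.
have sub : [set e in late p | gf_accept f M r eps p e] \subset \bigcup_(i in First) Acc i.
  apply/subsetP => e; rewrite inE gf_acceptE => /andP[el /existsP[i /andP[eM lt]]].
  have [j /eqP Ej minj] := @arg_minnP _ i [pred j | lev j == lev i] val (eqxx _).
  have ji : (j <= i)%N by apply: minj => /=.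
  apply/bigcupP; exists j.
    by rewrite inE; apply/forallP => l; apply/implyP; rewrite Ej => /minj.
  rewrite inE el /accepts (subset_indep _ eM) /=; last by rewrite setUS // gf_S_mono.
  rewrite -[rounding _ (gain p j)]/(lev j) Ej; apply: lt_le_trans lt _.
  apply/rounding_mono/marginal1_antimono => //; first exact: gf_S_mono.
  by apply: late_notin_S => //; apply: ltnW.
apply: (@le_trans _ _ (\sum_(i in First) #|Acc i|)%:R).
  by rewrite ler_nat; apply: leq_trans (subset_leq_card sub) (card_bigcup_le _ _).
rewrite natr_sum; apply: (@le_trans _ _ (\sum_(i in First) k)).
  by apply: ler_sum => i _; apply: Hk.
by rewrite sumr_const -(mulr_natl k) ler_wpM2r // ler_nat.
Qed.

(** If all acceptable elements together fit under the cap, so does every intermediate [H], and the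
    loop is never stopped early. *)
Lemma mem_gf_H p e :
  #|[set e in late p | gf_accept f M r eps p e]|%:R <= gf_cap f M r eps p ->
  e \in late p -> gf_accept f M r eps p e -> e \in gf_H f M r eps p.
Proof.
set Acc := [set e in _ | _] => cap el ea; rewrite /gf_H -/(late p).
suff /(_ (late p) set0) H0 s (H : {set 'I_n}) :
    {subset s <= late p} -> H \subset Acc -> (e \in s) || (e \in H) ->
    e \in foldl (gf_step f M r eps p) H s.
  by apply: H0; rewrite ?sub0set ?el.
elim: s H => [|x s IH] H sub sH; first by rewrite in_nil.
rewrite /= => eH; have xl : x \in late p by apply: sub; rewrite mem_head.
have capH : ~~ (gf_cap f M r eps p < #|H|%:R).
  by rewrite -leNgt; apply: le_trans cap; rewrite ler_nat subset_leq_card.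
apply: IH => [y ys||]; first by apply: sub; rewrite inE ys orbT.
  rewrite /gf_step (negPf capH); case: ifP => // xa.
  by rewrite subUset sub1set inE xl xa.
rewrite /gf_step (negPf capH); move: eH; rewrite in_cons -orbA => /or3P[/eqP <-|->|eH] //.
  by rewrite ea setU11 orbT.
by case: ifP => _; rewrite ?inE eH !orbT.
Qed.

Lemma gf_outputP p : gf_output f M r eps p \in M /\
  gf_output f M r eps p \subset gf_stored f M r eps p /\
  (forall X : {set 'I_n}, X \in M -> X \subset gf_stored f M r eps p ->
     f X <= f (gf_output f M r eps p)).
Proof.
rewrite /gf_output; case: arg_maxP; first by rewrite sub0set (matroid_set0 matM).
move=> X /andP[sX XM] maxX; split=> //; split=> // Y YM sY.
by apply: maxX; rewrite sY YM.
Qed.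

Lemma le_opt X : X \in M -> f X <= opt f M.
Proof. by move=> XM; rewrite /opt (@le_bigmax_cond _ _ _ _ X). Qed.

Lemma phase1_max_ge0 p : 0 <= phase1_max p.
Proof. exact: bigmax_ge_id. Qed.

Lemma phase1_max_le p : phase1_max p <= opt f M.
Proof.
apply: bigmax_le => [|e eM]; last exact: le_opt.
exact: le_trans (f_ge0 _) (le_opt (matroid_set0 matM)).
Qed.

Let K := ceil_nat (2 * (ln (r%:R / eps) / ln (1 + eps))).
Let c p := eps * phase1_max p / r%:R.

Lemma gf_IE p : I p = [seq (1 + eps) ^+ k * c p | k <- iota 0 K.+1].
Proof.
have rn0 : r%:R != 0 :> R by rewrite pnatr_eq0 -lt0n.
have [e0 _] := andP eps_bounds.
rewrite /gf_I /gf_w -/(phase1_max p) -/K; apply: eq_map => k; rewrite /c.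
by field; rewrite rn0 gt_eqF.
Qed.

(** The choice of [K] makes the grid span a factor of at least [(r / eps) ^ 2] above [c p], so its
    top is at least [r / eps * phase1_max p]. *)
Lemma phase1_max_le_top p : phase1_max p <= (1 + eps) ^+ K * c p.
Proof.
have [e0 e2] := andP eps_bounds.
have r1 : 1 <= r%:R :> R by rewrite ler1n.
have m0 := phase1_max_ge0 p.
have le1 : 1 <= r%:R / eps by rewrite ler_pdivlMr // mul1r; lra.
have ln1 : 0 < ln (1 + eps) by apply: lt_le_trans (ln1D_ge (ltW e0)); rewrite divr_gt0 //; lra.
have le2 : (r%:R / eps) ^+ 2 <= (1 + eps) ^+ K.
  rewrite -[X in X ^+ 2](lnK (x := r%:R / eps)) ?posrE ?divr_gt0 ?ltr0n //.
  rewrite -[X in X ^+ K](lnK (x := 1 + eps)) ?posrE; last by lra.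
  rewrite -!expRM_natl ler_expR -ler_pdivrMr // -mulrA; exact: ceil_nat_ge.
apply: (@le_trans _ _ ((r%:R / eps) ^+ 2 * c p)); last first.
  by rewrite ler_wpM2r // /c divr_ge0 ?mulr_ge0 // ltW.
have -> : (r%:R / eps) ^+ 2 * c p = r%:R / eps * phase1_max p.
  by rewrite /c; field; rewrite !gt_eqF // ltr0n.
by rewrite ler_peMl.
Qed.

(** The part of the bound without probability. The set [A] from [charging] and the set of positive
    greedy steps are both stored and independent, so each is worth at most the output. *)
Lemma good_stream_bound p (O : {set 'I_n}) :
  matroid_rank M = r -> uniq p -> (forall e, e \in p) -> O \in M ->
  (forall e, [set e] \in M -> e \notin gf_T f M eps p -> f [set e] <= phase1_max p) ->
  (forall i, (i < r)%N ->
    #|[set e in late p | accepts p i e]|%:R <= r%:R / eps * ln (r%:R / eps)) ->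
  f ((O :\: [set e in take (P + r * W) p]) :|: S p r) <=
    (2 + eps) * f (gf_output f M r eps p) + 3 * eps * opt f M.
Proof.
move=> rankM up allp OM good0 good1.
have [e0 e2] := andP eps_bounds.
have r1 : 1 <= r%:R :> R by rewrite ler1n.
have m0 := phase1_max_ge0 p.
have le1 : 1 <= r%:R / eps by rewrite ler_pdivlMr // mul1r; lra.
have c0 : 0 <= c p by rewrite /c divr_ge0 ?mulr_ge0 // ltW.
set O' := O :\: _.
have O'M : O' \in M by apply: subset_indep OM; apply: subsetDl.
have O'late e : e \in O' -> e \in late p.
  rewrite !inE => /andP[ne _]; have := allp e.
  by rewrite -{1}(cat_take_drop (P + r * W) p) mem_cat (negPf ne).
(* [card_I] times the bound per index is exactly the cap. *)
have Hcap : #|[set e in late p | gf_accept f M r eps p e]|%:R <= gf_cap f M r eps p.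
  apply: le_trans (card_accepted up _ good1) _.
    by rewrite mulr_ge0 ?divr_ge0 ?ln_ge0 // ltW.
  by rewrite le_eqVlt /gf_cap; apply/orP; left; apply/eqP; field; rewrite gt_eqF.
pose Hs := O' :&: (gf_T f M eps p :|: gf_H f M r eps p).
pose rest := O' :\: (gf_T f M eps p :|: gf_H f M r eps p).
(* The factor [1 + eps] and the floor [c p] are the price of rounding. *)
pose w i := (1 + eps) * Num.max (gain p i) (c p).
have Hrest : Hs :|: rest = O' by apply: setID.
have disjS (X : {set 'I_n}) : X \subset O' -> [disjoint X & S p r].
  move=> sX; rewrite -setI_eq0; apply/eqP/setP => x; rewrite !inE; apply/negP => /andP[xX xS].
  by have := late_notin_S up (leqnn r) (O'late _ (subsetP sX _ xX)); rewrite xS.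
have [|||||||||A [AM sA leA]] :=
  @charging R n f M matM sf (fun i => S p i) r erefl (gf_S_step f M r eps p) Hs rest w
    ((1 + eps) * c p) (fun i _ => gf_S_indep p i).
- by rewrite Hrest.
- rewrite -setI_eq0 /Hs /rest; move: (_ :|: _) => X; apply/eqP/setP => x; rewrite !inE.
  by case: (x \in X); rewrite ?andbF.
- by apply: disjS; apply: subsetIl.
- by apply: disjS; apply: subsetDl.
- move=> i _; rewrite -/(gain p i) /w.
  apply: (@le_trans _ _ (Num.max (gain p i) (c p))).
    by rewrite ge_max !le_max lexx c0 orbT.
  by rewrite ler_peMl ?le_max ?c0 ?orbT //; lra.
(* Being outside [T], a lost element does not exceed the top of the grid; being outside [H], it does
   not beat the gain of step [i] after rounding. *)
- move=> i e ir erest eSM; have eO' : e \in O' by apply: subsetP erest; apply: subsetDl.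
  have el := O'late _ eO'.
  move: erest; rewrite 2!inE negb_or => /andP[/andP[eT eH] _].
  apply: geometric_rounding => //; first exact: ltW.
    apply: le_trans (phase1_max_le_top p).
    apply: le_trans (good0 e _ eT); last by apply: subset_indep OM; rewrite sub1set;
      move: eO'; rewrite inE => /andP[].
    have := marginal1_antimono sf (sub0set (S p i)) (late_notin_S up (ltnW ir) el).
    by rewrite /marginal setU0; have := f_ge0 set0; lra.
  rewrite -gf_IE leNgt; apply: contra eH => lt.
  apply: mem_gf_H => //; rewrite gf_acceptE; apply/existsP; exists (Ordinal ir).
  by rewrite /accepts eSM.
- move=> i _ E; rewrite /w /gain E subrr.
  by rewrite (max_idPr c0).
- exact: rankM.
- by rewrite mulr_ge0 //; lra.
have [_ [_ maxout]] := gf_outputP p.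
have fA : f A <= f (gf_output f M r eps p).
  apply: maxout => //; apply: (subset_trans sA); rewrite /gf_stored.
  rewrite subUset; apply/andP; split.
    apply: subset_trans (subsetIr _ _) _; rewrite subUset subsetUr andbT.
    by rewrite -setUA subsetUl.
  by apply: subset_trans (subsetUl _ _); apply: subsetUr.
have [Q sQ leQ] := @positive_steps_le R n f sf (fun i => S p i) r (gf_S_step f M r eps p).
have fQ : f Q <= f (gf_output f M r eps p).
  apply: maxout; first exact: subset_indep sQ (gf_S_indep p r).
  apply: subset_trans sQ _; rewrite /gf_stored.
  by apply: subset_trans (subsetUl _ _); apply: subsetUr.
have sumw : \sum_(i < r) w i <=
    (1 + eps) * (\sum_(i < r) Num.max (gain p i) 0 + r%:R * c p).
  rewrite -mulr_sumr ler_wpM2l //; first by lra.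
  have -> : r%:R * c p = \sum_(i < r) c p by rewrite sumr_const card_ord mulr_natl.
  rewrite -big_split /=.
  apply: ler_sum => i _; rewrite ge_max; apply/andP; split.
    by rewrite ler_wpDr // le_max lexx.
  by rewrite ler_wpDl // le_max lexx orbT.
have rc : r%:R * c p <= eps * opt f M.
  have -> : r%:R * c p = eps * phase1_max p by rewrite /c; field; rewrite gt_eqF ?ltr0n.
  by rewrite ler_wpM2l ?phase1_max_le // ltW.
move: leA leQ; rewrite Hrest.
rewrite -[\sum_(i < r) Num.max _ 0]/(\sum_(i < r) Num.max (gain p i) 0).
set T1 := \sum_(i < r) w i in sumw *; set T2 := \sum_(i < r) _ in sumw *.
rewrite [r%:R * ((1 + eps) * _)]mulrCA => leA leQ.
have rc0 : 0 <= r%:R * c p by rewrite mulr_ge0.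
have T2a : (1 + eps) * T2 <= (1 + eps) * f (gf_output f M r eps p).
  by rewrite ler_wpM2l //; have := f_ge0 set0; lra.
have erc : eps * (r%:R * c p) <= 2^-1 * (r%:R * c p) by rewrite ler_wpM2r // ltW.
(* The term [r%:R * c p] enters with factor [2 * (1 + eps)], at most 3 as [eps] is below one
   half. *)
by move: rc sumw T2a leA; rewrite -mulrA; lra.
Qed.

End GoodStream.

(** * Random streams *)

Section Stream.
Variable n : nat.
Implicit Types (pi s : 'S_n) (e : 'I_n).

Lemma size_stream pi : size (stream pi) = n.
Proof. by rewrite size_map size_enum_ord. Qed.

Lemma stream_uniq pi : uniq (stream pi).
Proof. by rewrite map_inj_uniq ?enum_uniq //; apply: perm_inj. Qed.

Lemma mem_stream pi e : e \in stream pi.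
Proof. by rewrite -[e](permKV pi) map_f // mem_enum. Qed.

Lemma mem_take_stream pi t e : (e \in take t (stream pi)) = ((pi^-1)%g e < t)%N.
Proof.
rewrite in_take ?mem_stream // -[in index e _](permKV pi e) index_map; last exact: perm_inj.
by rewrite index_enum_ord.
Qed.

Lemma mem_drop_stream pi t e : (e \in drop t (stream pi)) = (t <= (pi^-1)%g e)%N.
Proof.
have := mem_stream pi e; rewrite -{1}(cat_take_drop t (stream pi)) mem_cat.
have := stream_uniq pi; rewrite -{1}(cat_take_drop t (stream pi)) cat_uniq.
case/and3P => _ /hasPn/(_ e) + _; rewrite leqNgt -mem_take_stream.
by case: (e \in drop _ _); case: (e \in take _ _) => //= /(_ isT).
Qed.

Lemma mem_window_stream pi a w e : (a <= (pi^-1)%g e < a + w)%N ->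
  e \in take w (drop a (stream pi)).
Proof.
case/andP => ae ew; rewrite take_drop addnC.
have : e \in take (a + w) (stream pi) by rewrite mem_take_stream.
rewrite -{1}(cat_take_drop a (take _ _)) mem_cat take_takel ?leq_addr //.
by rewrite mem_take_stream ltnNge ae.
Qed.

Lemma take_stream_prefix t : prefix_determined t (fun pi => take t (stream pi)).
Proof.
move=> s pi fs; have streamE rho : take t (stream rho) = [seq rho j | j <- take t (enum 'I_n)].
  by rewrite /stream map_take.
rewrite !streamE; apply/eq_in_map => j.
move=> jt; have {}jt : (j < t)%N by rewrite -(index_enum_ord j) -in_take ?mem_enum.
by rewrite permM fs.
Qed.

Lemma take_rcons_stream pi (t : 'I_n) :
  take t.+1 (stream pi) = rcons (take t (stream pi)) (pi t).
Proof.
rewrite (take_nth (pi t)) ?size_stream // /stream (nth_map t) ?size_enum_ord //.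
by rewrite nth_ord_enum.
Qed.

Lemma window_avoid_prob (R : realType) (A : pred 'S_n) (B : 'S_n -> {set 'I_n})
    (a W k : nat) (y : R) :
  prefix_determined a A -> prefix_determined a B ->
  (forall pi i, pi i \in B pi -> (a <= i)%N) ->
  (forall pi, A pi -> (k <= #|B pi|)%N) -> (a + W <= n)%N -> (0 < n)%N ->
  0 < y -> ln y^-1 * n%:R <= (k * W)%:R ->
  #|[set pi | A pi & [forall i : 'I_n, (a <= i < a + W)%N ==> (pi i \notin B pi)]]|%:R
    <= (n`!)%:R * y.
Proof.
move=> dA dB lB kB aW n0 y0 lny; have [kn|nk] := leqP k n; last first.
  rewrite eq_card0 => [|pi]; first by rewrite mulr_ge0 // ltW.
  rewrite !inE; apply/negP => /andP[/kB /leq_trans/(_ (max_card _))].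
  by rewrite card_ord leqNgt nk.
have := card_window_avoid dA dB lB kB aW.
move/(expR_decay y0 n0 kn lny)/le_trans; apply; rewrite (ler_wpM2r (ltW y0)) // ler_nat.
by rewrite -card_Sn -cardsT subset_leq_card // subsetT.
Qed.

End Stream.

(** * Value of the optimum after losing its early elements *)

Section Sampling.
Variables (R : realType) (n : nat) (f : {set 'I_n} -> R).
Hypothesis f_ge0 : forall X, 0 <= f X.
Hypothesis sf : lattice_submodular f.

(* Submodularity turns the union with the partially lost [O] into a union and a
   difference, to which the sampling lemma applies separately. *)
Lemma early_sampling (L : nat) (O : {set 'I_n}) (D : 'S_n -> {set 'I_n}) :
  (0 < n)%N -> (L <= n)%N ->
  (forall pi e, e \in D pi -> ((pi^-1)%g e < L)%N) ->
  (1 - 2 * (L%:R / n%:R)) * f O * (n`!)%:R <=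
    \sum_(pi : 'S_n) f ((O :\: [set e in take L (stream pi)]) :|: D pi).
Proof.
move=> n0 Ln DL; have n0' : 0 < n%:R :> R by rewrite ltr0n.
pose E (pi : 'S_n) := [set e in take L (stream pi)].
(* The sampling lemma with lower frequency 0: each element is early in a fraction [L / n] of the
   orders. *)
have bound (C : 'S_n -> {set 'I_n}) (g : {set 'I_n} -> R) :
    (forall pi, C pi \subset E pi) -> (forall X, 0 <= g X) -> lattice_submodular g ->
    (1 - L%:R / n%:R) * g set0 * (n`!)%:R <= \sum_pi g (C pi).
  move=> CE g0 sg.
  have := @submodular_sampling R n _ g C (L%:R / n%:R * (n`!)%:R) 0 setT g0 sg.
  rewrite mul0r addr0 card_Sn => H.
  rewrite [leLHS](_ : _ = ((n`!)%:R - L%:R / n%:R * (n`!)%:R) * g set0); last by ring.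
  apply: H.
  - by move=> pi; apply: subsetT.
  - move=> e _; rewrite ler0n /= -(ler_pM2l n0') mulrA mulrCA divff ?gt_eqF // mulr1.
    rewrite -!natrM -(card_perm_early e Ln) ler_nat leq_mul2l; apply/orP; right.
    apply: subset_leq_card; apply/subsetP => pi; rewrite !inE => /(subsetP (CE pi)).
    by rewrite inE mem_take_stream.
  - by rewrite mulr_ge0 ?divr_ge0.
have sU : lattice_submodular (fun X => f (O :|: X)).
  by move=> A B; have := sf (O :|: A) (O :|: B); rewrite -setUUr -setUIr.
have sD : lattice_submodular (fun X => f (O :\: X)).
  by move=> A B; have := sf (O :\: A) (O :\: B); rewrite -setDIr -setDUr addrC.
have DE pi : D pi \subset E pi.
  by apply/subsetP => e /DL; rewrite inE mem_take_stream.
have := bound D _ DE (fun X => f_ge0 _) sU.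
have := bound (fun pi => E pi :\: D pi) _ (fun pi => subsetDl _ _) (fun X => f_ge0 _) sD.
rewrite setU0 setD0 => H1 H2.
(* The left-hand terms are the union and the intersection of [O] with the set on the right. Each
   averages at least [(1 - L / n) * f O], and one [f O] is subtracted. *)
have : \sum_pi (f (O :|: D pi) + f (O :\: (E pi :\: D pi)) - f O) <=
       \sum_pi f ((O :\: E pi) :|: D pi).
  apply: ler_sum => pi _; have := sf ((O :\: E pi) :|: D pi) O.
  have -> : (O :\: E pi) :|: D pi :|: O = O :|: D pi.
    by apply/setP => x; rewrite !inE; case: (x \in O); case: (x \in D pi); rewrite ?orbT ?andbF.
  have -> : ((O :\: E pi) :|: D pi) :&: O = O :\: (E pi :\: D pi).
    by apply/setP => x; rewrite !inE; case: (x \in O); case: (x \in D pi);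
      case: (x \in take _ _).
  lra.
rewrite sumrB big_split /= sumr_const card_Sn -(mulr_natl (f O)).
move: H1 H2; rewrite !mulrBl !mul1r; lra.
Qed.

End Sampling.

(** * Unlucky streams and their probabilities *)

Section Events.
Variables (R : realType) (n : nat) (f : {set 'I_n} -> R) (M : {set {set 'I_n}}).
Variables (r : nat) (eps : R).
Hypothesis f_ge0 : forall X, 0 <= f X.
Hypothesis sf : lattice_submodular f.
Hypothesis matM : matroid M.
Hypothesis r0 : (0 < r)%N.
Hypothesis eps_bounds : 0 < eps < 2^-1.
Hypothesis n0 : (0 < n)%N.
Implicit Types (p q : seq 'I_n) (e x : 'I_n) (pi : 'S_n).

Local Notation P := (@phase1_len R n eps).
Local Notation W := (@window_len R n r eps).
Local Notation S p i := (gf_S f M r eps p i).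
Local Notation K := (top_size eps).
Hypothesis lenn : (P + r * W <= n)%N.

Definition nonloops : {set 'I_n} := [set e | [set e] \in M].
Definition top_nonloops : {set 'I_n} := top_set nonloops (fun e => f [set e]) K.

(** With fewer than [K] nonloops all of them fit into [T], and no stream counts as a miss. *)
Definition phase1_miss : {set 'S_n} :=
  [set pi : 'S_n | (K <= #|nonloops|)%N &
     [forall i : 'I_n, (0 <= i < 0 + P)%N ==> (pi i \notin top_nonloops)]].

Lemma card_phase1_miss : #|phase1_miss|%:R <= (n`!)%:R * eps.
Proof.
have [e0 e2] := andP eps_bounds.
apply: (@window_avoid_prob _ R _ (fun=> top_nonloops) 0 P K) => //.
- by move=> pi; apply: card_top_set.
- by rewrite add0n; apply: leq_trans lenn; apply: leq_addr.
rewrite natrM; apply: (@le_trans _ _ (K%:R * (eps * n%:R))).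
  rewrite mulrA ler_wpM2r // -ler_pdivrMr //; exact: ceil_nat_ge.
by rewrite ler_wpM2l //; apply: ceil_nat_ge.
Qed.

(** Phase 1 has seen some [v] of the top set. If [e] were above the phase 1 maximum, the [K]
    elements of [T] would all be strictly above [v], which is impossible. *)
Lemma top_singletons pi e : pi \notin phase1_miss ->
  [set e] \in M -> e \notin gf_T f M eps (stream pi) ->
  f [set e] <= phase1_max f M eps (stream pi).
Proof.
move=> good eM; rewrite /gf_T inE; set leT := fun _ _ => _; set L := sort _ _ => eT.
have leT_tr : transitive leT by move=> a b c /[swap]; apply: le_trans.
have leT_tot : total leT by move=> a b; apply: le_total.
have memL x : (x \in L) = ([set x] \in M).
  by rewrite mem_sort mem_filter mem_stream andbT.
have uL : uniq L by rewrite sort_uniq filter_uniq // stream_uniq.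
have eD : e \in drop K L.
  by have := memL e; rewrite eM -{1}(cat_take_drop K L) mem_cat (negPf eT).
have ltK : (K < size L)%N.
  by rewrite ltnNge; apply/negP => le; move: eD; rewrite drop_oversize.
have cN : (K <= #|nonloops|)%N.
  apply: leq_trans (ltnW ltK) _; rewrite -(card_uniqP uL); apply: subset_leq_card.
  by apply/subsetP => x; rewrite memL inE.
have [i iP iT] : exists2 i : 'I_n, (i < P)%N & pi i \in top_nonloops.
  apply/exists_inP; apply: contraR good; rewrite negb_exists_in => /forall_inP H.
  by rewrite inE cN; apply/forall_inP => i /andP[_]; apply: H.
move: iT; rewrite inE => /andP[vN vK]; rewrite leNgt; apply/negP => lt.
have vmax : f [set pi i] <= phase1_max f M eps (stream pi).
  apply: (@le_bigmax_seq _ _ _ _ _ (pi i)); last by rewrite inE in vN.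
  by rewrite mem_take_stream permK.
move: vK; rewrite ltnNge; case/negP.
have -> : K = #|[set x in take K L]|.
  by rewrite cardsE (card_uniqP _) ?take_uniq // size_takel // ltnW.
apply: subset_leq_card; apply/subsetP => x; rewrite !inE => xT.
rewrite -memL (mem_take xT) /=; apply: (le_lt_trans vmax); apply: (lt_le_trans lt).
exact: (sorted_take_ge leT_tr (sort_sorted leT_tot _) xT eD).
Qed.

Let q0 := r%:R / eps * ln (r%:R / eps).
Let k := ceil_nat q0.

Definition feasible i pi : {set 'I_n} :=
  [set e | (e \notin take (P + i * W) (stream pi)) && (e |: S (stream pi) i \in M)].
Definition top_feasible i pi : {set 'I_n} :=
  top_set (feasible i pi) (fun e => marginal f [set e] (S (stream pi) i)) k.

(** Indices are shifted: this window is the one from which [s_{i+1}] is chosen. *)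
Definition window_miss i : {set 'S_n} :=
  [set pi : 'S_n | (k <= #|feasible i pi|)%N &
     [forall j : 'I_n, (P + i * W <= j < P + i * W + W)%N ==> (pi j \notin top_feasible i pi)]].

(** The window has at least [eps * n / r] arrivals, so [k * W] is at least [ln (r / eps) * n]. The
    bound sums to [eps] over the [r] windows. *)
Lemma card_window_miss i : (i < r)%N -> #|window_miss i|%:R <= (n`!)%:R * (eps / r%:R).
Proof.
move=> ir; have [e0 e2] := andP eps_bounds.
have r1 : 0 < r%:R :> R by rewrite ltr0n.
have dS : prefix_determined (P + i * W) (fun pi => S (stream pi) i).
  move=> s pi fs; rewrite -(@gf_S_take _ _ f M r eps (stream (s * pi)) (P + i * W)) //.
  by rewrite (take_stream_prefix pi fs) gf_S_take.
have dF : prefix_determined (P + i * W) (feasible i).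
  by move=> s pi fs; rewrite /feasible (take_stream_prefix pi fs) dS.
apply: (@window_avoid_prob _ R (fun pi => k <= #|feasible i pi|)%N (top_feasible i) _ W k) => //.
- by move=> s pi fs; rewrite dF.
- by move=> s pi fs; rewrite /top_feasible dF // dS.
- by move=> pi j; rewrite !inE mem_take_stream permK -leqNgt => /andP[/andP[]].
- by move=> pi; apply: card_top_set.
- by apply: leq_trans lenn; rewrite -addnA -mulSnr leq_add2l leq_mul2r ir orbT.
- by rewrite divr_gt0.
rewrite invf_div natrM; apply: (@le_trans _ _ (q0 * (eps * n%:R / r%:R))); last first.
  apply: ler_pM; [| by rewrite !mulr_ge0 ?invr_ge0 ?ler0n // ltW | |];
    try exact: ceil_nat_ge.
  rewrite mulr_ge0 ?divr_ge0 ?(ltW e0) ?ler0n ?ln_ge0 //.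
  by rewrite ler_pdivlMr // mul1r; have : 1 <= r%:R :> R; [rewrite ler1n | lra].
rewrite le_eqVlt /q0; apply/orP; left; apply/eqP; field.
by rewrite !gt_eqF.
Qed.

Lemma gain_ge pi i e : e \in gf_V r eps (stream pi) i.+1 -> e |: S (stream pi) i \in M ->
  marginal f [set e] (S (stream pi) i) <= gain f M r eps (stream pi) i.
Proof.
set p := stream pi => eV eM.
have gainE : gain f M r eps p i =
    marginal f (set_of_option (gf_select f M r eps p i.+1 (S p i))) (S p i).
  by rewrite /gain /marginal setUC.
have [s Es le] : exists2 s, gf_select f M r eps p i.+1 (S p i) = Some s &
    marginal f [set e] (S p i) <= marginal f [set s] (S p i).
  rewrite /gf_select; case: eqP => [[i0]|_].
    rewrite i0 in eV eM *; rewrite /= setU0 in eM.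
    have eF : e \in [seq x <- gf_V r eps p 1 | [set x] \in M] by rewrite mem_filter eM.
    rewrite /gf_s1; case E: first_argmax => [s|].
      exists s => //; have [_ /(_ e eF)] := first_argmaxP E.
      by rewrite /marginal !setU0 lerD2r.
    by move: eF; rewrite (first_argmax_None E).
  set F := [seq _ <- _ | _].
  have eF : e \in F by rewrite mem_filter eM mem_cat eV orbT.
  case E: first_argmax => [s|]; last by move: eF; rewrite (first_argmax_None E).
  by exists s => //; have [_ /(_ e eF)] := first_argmaxP E.
by rewrite gainE Es set_of_optionE.
Qed.

(** The window contains a top feasible element, of marginal value at most the gain. Accepted
    elements are strictly above the gain, so [k] of them would expel it from the top set. *)
Lemma few_accepted pi i : (i < r)%N -> pi \notin window_miss i ->
  #|[set e in late r eps (stream pi) | accepts f M r eps (stream pi) i e]|%:R <= q0.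
Proof.
move=> ir good; set Acc := [set e in _ | _]; rewrite leNgt; apply/negP => lt.
have kAcc : (k <= #|Acc|)%N.
  have q00 : 0 <= q0.
    have [e0 e2] := andP eps_bounds.
    rewrite mulr_ge0 ?divr_ge0 ?(ltW e0) ?ler0n ?ln_ge0 //.
    by rewrite ler_pdivlMr // mul1r; have : 1 <= r%:R :> R; [rewrite ler1n | lra].
  have : k%:R < #|Acc|%:R + 1 :> R by apply: lt_trans (ceil_nat_lt q00) _; rewrite ltrD2r.
  by rewrite natr1 ltr_nat ltnS.
have AccF : Acc \subset feasible i pi.
  apply/subsetP => e; rewrite !inE mem_drop_stream mem_take_stream -leqNgt.
  case/andP => le /andP[-> _]; rewrite andbT; apply: leq_trans le.
  by rewrite leq_add2l leq_mul2r ltnW ?orbT.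
have kF := leq_trans kAcc (subset_leq_card AccF).
have [j jV jT] : exists2 j : 'I_n, (P + i * W <= j < P + i * W + W)%N & pi j \in top_feasible i pi.
  apply/exists_inP; apply: contraR good; rewrite negb_exists_in => /forall_inP H.
  by rewrite inE kF; apply/forall_inP.
move: jT; rewrite inE => /andP[jF]; rewrite ltnNge; case/negP.
apply: leq_trans kAcc _; apply: subset_leq_card; apply/subsetP => e eA.
rewrite inE (subsetP AccF) //=; move: eA; rewrite inE => /andP[_ /andP[_ lt']].
have jV' : pi j \in gf_V r eps (stream pi) i.+1.
  by rewrite /gf_V mem_window_stream // permK.
have jM : pi j |: S (stream pi) i \in M by move: jF; rewrite inE => /andP[].
apply: le_lt_trans (gain_ge jV' jM) _; rewrite ltNge; apply: contraTN lt' => le.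
by rewrite -leNgt rounding_mono.
Qed.

End Events.

(** * Approximation ratio and memory *)

Section Guarantee.
Variables (R : realType) (n : nat) (f : {set 'I_n} -> R) (M : {set {set 'I_n}}).
Variables (r : nat) (eps : R).
Hypothesis f_ge0 : forall X, 0 <= f X.
Hypothesis sf : lattice_submodular f.
Hypothesis matM : matroid M.
Hypothesis rankM : matroid_rank M = r.
Hypothesis r0 : (0 < r)%N.
Hypothesis eps_bounds : 0 < eps < 2^-1.

Lemma ground_set_gt0 : (0 < n)%N.
Proof.
rewrite lt0n; apply/eqP => n0; move: r0; rewrite -rankM lt0n; apply/negP; rewrite negbK.
rewrite -leqn0; apply/bigmax_leqP => X _; apply: leq_trans (max_card _) _.
by rewrite card_ord n0.
Qed.

(** Rounding up costs less than 1 in phase 1 and in each of the [r] windows, and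
    [r + 1 <= 2 * r]. *)
Lemma early_length_le :
  (@phase1_len R n eps + r * @window_len R n r eps)%:R <= n%:R * (2 * eps + 2 * r%:R / n%:R).
Proof.
have [e0 e2] := andP eps_bounds.
have n0 : 0 < n%:R :> R by rewrite ltr0n ground_set_gt0.
have r1 : 1 <= r%:R :> R by rewrite ler1n.
have en0 : 0 <= eps * n%:R by rewrite mulr_ge0 // ltW.
have -> : n%:R * (2 * eps + 2 * r%:R / n%:R) = 2 * (eps * n%:R) + 2 * r%:R.
  by field; rewrite gt_eqF.
rewrite natrD natrM.
have h1 : (@phase1_len R n eps)%:R < eps * n%:R + 1 := ceil_nat_lt en0.
have h2 : (@window_len R n r eps)%:R < eps * n%:R / r%:R + 1.
  by apply: ceil_nat_lt; rewrite divr_ge0.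
have : r%:R * (@window_len R n r eps)%:R <= r%:R * (eps * n%:R / r%:R + 1).
  by rewrite ler_wpM2l // ltW.
rewrite mulrDr mulr1 mulrCA divff ?mulr1; last by rewrite gt_eqF // ltr0n.
lra.
Qed.

Lemma subadditive (X Y : {set 'I_n}) : f (X :|: Y) <= f X + f Y.
Proof. by have := sf X Y; have := f_ge0 (X :&: Y); lra. Qed.

(** Compares the average from [early_sampling] with the bound on good streams; on bad streams,
    subadditivity bounds the value by twice the optimum. *)
Lemma expected_output_ge :
  2 * eps + 2 * r%:R / n%:R < 1 ->
  (2^-1 - 3 * (2 * eps + 2 * r%:R / n%:R)) * opt f M <=
    expectation_perm (fun pi => f (gf_output f M r eps (stream pi))).
Proof.
set delta := 2 * eps + _ => d1.
have [e0 e2] := andP eps_bounds.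
have n0 := ground_set_gt0.
have n0' : 0 < n%:R :> R by rewrite ltr0n.
have r1 : 1 <= r%:R :> R by rewrite ler1n.
set L := (@phase1_len R n eps + r * @window_len R n r eps)%N.
have Ld : L%:R <= n%:R * delta := early_length_le.
have Ln : (L <= n)%N.
  by rewrite -(ler_nat R) (le_trans Ld) // ler_piMr // ltW.
have Ldn : L%:R / n%:R <= delta by rewrite ler_pdivrMr // mulrC.
have fact0 : 0 < (n`!)%:R :> R by rewrite ltr0n fact_gt0.
have [O OM optO] : exists2 O, O \in M & opt f M = f O.
  have [O OM E] := @eq_bigmax _ R _ 0 _ [in M] f (matroid_set0 matM) (fun X _ => f_ge0 X).
  by exists O.
have o0 : 0 <= opt f M by rewrite optO.
set out := fun pi : 'S_n => gf_output f M r eps (stream pi).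
have outM pi : out pi \in M by case: (gf_outputP f r eps matM (stream pi)).
have out_opt pi : f (out pi) <= opt f M := le_opt f (outM pi).
pose Z (pi : 'S_n) := (O :\: [set e in take L (stream pi)]) :|: gf_S f M r eps (stream pi) r.
(* Counting the unlucky events turns the union bound into a sum of indicators. *)
pose miss (pi : 'S_n) : R := (pi \in phase1_miss f M eps)%:R +
  \sum_(i < r) (pi \in window_miss f M r eps i)%:R.
have Zle pi : f (Z pi) <= (2 + eps) * f (out pi) + 3 * eps * opt f M + miss pi * (2 * opt f M).
  have main0 : 0 <= (2 + eps) * f (out pi) + 3 * eps * opt f M.
    by rewrite addr_ge0 ?mulr_ge0 ?f_ge0 //; lra.
  have sum0 : 0 <= \sum_(i < r) (pi \in window_miss f M r eps i)%:R :> R.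
    by apply: sumr_ge0.
  have bad : 1 <= miss pi ->
      f (Z pi) <= (2 + eps) * f (out pi) + 3 * eps * opt f M + miss pi * (2 * opt f M).
    move=> m1; have Z2 : f (Z pi) <= 2 * opt f M.
      apply: le_trans (subadditive _ _) _.
      have := le_opt f (gf_S_indep f r eps matM (stream pi) r).
      have : f (O :\: [set e in take L (stream pi)]) <= opt f M.
        by apply/le_opt/(subset_indep matM _ OM)/subsetDl.
      lra.
    have : 2 * opt f M <= miss pi * (2 * opt f M) by rewrite ler_peMl ?mulr_ge0.
    lra.
  have [b0|g0] := boolP (pi \in phase1_miss f M eps).
    by apply: bad; rewrite /miss b0 lerDl.
  have [/existsP[i bi]|] := boolP [exists i : 'I_r, pi \in window_miss f M r eps i].
    apply: bad; rewrite /miss (bigD1 i) //= bi addrCA lerDl addr_ge0 ?ler0n //.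
    by apply: sumr_ge0.
  rewrite negb_exists => /forallP gi.
  rewrite [miss pi](_ : _ = 0) ?mul0r ?addr0; last first.
    by rewrite /miss (negPf g0) add0r big1 // => i _; rewrite (negPf (gi i)).
  apply: good_stream_bound => //; try exact: stream_uniq; try exact: mem_stream.
  - by move=> e; apply: top_singletons.
  - by move=> i ir; apply: few_accepted => //; apply: (gi (Ordinal ir)).
have sumZ := @early_sampling R n f f_ge0 sf L O (fun pi => gf_S f M r eps (stream pi) r) n0 Ln.
have {}sumZ : (1 - 2 * (L%:R / n%:R)) * f O * (n`!)%:R <= \sum_pi f (Z pi).
  apply: sumZ => pi e; rewrite -mem_take_stream; exact: gf_S_early.
have sum_miss : \sum_pi miss pi <= (n`!)%:R * (2 * eps).
  rewrite big_split /= exchange_big /=.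
  have cardE (A : {set 'S_n}) : \sum_pi (pi \in A)%:R = #|A|%:R :> R.
    by rewrite -natr_sum -sum1_card [in RHS]big_mkcond /=; congr (_%:R);
      apply: eq_bigr => pi _; case: (_ \in _).
  rewrite cardE; have := card_phase1_miss f M eps_bounds n0 Ln.
  have : \sum_(i < r) \sum_pi (pi \in window_miss f M r eps i)%:R <= (n`!)%:R * eps.
    apply: (@le_trans _ _ (\sum_(i < r) (n`!)%:R * (eps / r%:R))).
      by apply: ler_sum => i _; rewrite cardE; apply: card_window_miss.
    by rewrite sumr_const card_ord -(mulr_natr (_ * _)) -mulrA mulfVK // pnatr_eq0 -lt0n.
  lra.
have sumOut : \sum_pi f (out pi) <= (n`!)%:R * opt f M.
  apply: (le_trans (ler_sum _ (fun pi _ => out_opt pi))).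
  by rewrite sumr_const card_Sn mulr_natl.
have : \sum_pi f (Z pi) <=
    \sum_pi ((2 + eps) * f (out pi) + 3 * eps * opt f M + miss pi * (2 * opt f M)).
  by apply: ler_sum.
rewrite !big_split /= sumr_const card_Sn -(mulr_natl (3 * eps * _)) -mulr_sumr -mulr_suml.
rewrite /expectation_perm ler_pdivlMr // -/out.
move: (\sum_pi f (out pi)) sumOut => E sumOut.
move: (\sum_pi f (Z pi)) sumZ => z sumZ; move: (\sum_pi miss pi) sum_miss => m sum_miss hz.
rewrite -optO in sumZ.
set F := (n`!)%:R in fact0 sumZ sumOut sum_miss hz *.
have h1 : m * (2 * opt f M) <= F * (2 * eps) * (2 * opt f M) by rewrite ler_wpM2r // mulr_ge0.
have h2 : eps * E <= eps * (F * opt f M) by rewrite ler_wpM2l // ltW.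
have FO : 0 <= opt f M * F by rewrite mulr_ge0 // ltW.
have h3 : (1 - 2 * delta) * opt f M * F <= (1 - 2 * (L%:R / n%:R)) * opt f M * F.
  by rewrite -!mulrA ler_wpM2r //; lra.
have h4 : 2 * eps * (opt f M * F) <= delta * (opt f M * F).
  by rewrite ler_wpM2r // /delta lerDl divr_ge0 ?mulr_ge0.
(* With [E] divided by [F]: [(1 - 2 delta) opt <= 2 E + (1 + 3 + 4) eps opt], the last three terms
   coming from [eps * E], rounding and misses. Finally [8 eps <= 4 delta]. *)
nra.
Qed.

Lemma ln_ratio_ge : 2^-1 <= ln (r%:R / eps).
Proof.
have [e0 e2] := andP eps_bounds.
have r1 : 1 <= r%:R :> R by rewrite ler1n.
have := @ln1D_ge R 1 ler01; rewrite div1r => /le_trans; apply.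
rewrite ler_ln ?posrE ?addr_gt0 ?divr_gt0 ?ltr0n //.
by rewrite ler_pdivlMr //; lra.
Qed.

(** With [u = ln (r / eps) / eps >= 1], the three parts have at most [u + 1], [r] and
    [r u (3 u + 2) + 1] elements. Bounding each term by a multiple of [r u ^ 2] gives
    [2 + 1 + 6 = 9]. *)
Lemma memory_bound p :
  #|gf_stored f M r eps p|%:R <= 9 * (r%:R * ln (r%:R / eps) ^+ 2 / eps ^+ 2).
Proof.
have [e0 e2] := andP eps_bounds.
have r1 : 1 <= r%:R :> R by rewrite ler1n.
have l2 := ln_ratio_ge; set l := ln _ in l2 *.
have -> : r%:R * l ^+ 2 / eps ^+ 2 = r%:R * (l / eps) ^+ 2 by field; rewrite gt_eqF.
set u := l / eps.
have u1 : 1 <= u by rewrite /u ler_pdivlMr //; lra.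
have ln1 : 2 / 3 * eps <= ln (1 + eps).
  apply: le_trans (ln1D_ge (ltW e0)); rewrite ler_pdivlMr; last by lra.
  by nra.
have cT : (top_size eps)%:R <= u + 1.
  have lnle : ln eps^-1 <= l.
    by rewrite ler_ln ?posrE ?invr_gt0 ?divr_gt0 ?ltr0n // ler_peMl // invr_ge0 ltW.
  apply: le_trans (ltW (ceil_nat_lt _)) _.
    by rewrite divr_ge0 ?ln_ge0 ?(ltW e0) // invf_ge1 //; lra.
  by rewrite lerD2r /u ler_wpM2r // invr_ge0 ltW.
(* The slope 3 comes from [ln (1 + eps) >= 2 / 3 * eps], the constant 2 from rounding up and the
   exponent 0. *)
have cI : (card_I f M r eps p)%:R <= 3 * u + 2.
  apply: (@le_trans _ _ (size (gf_I f M r eps p))%:R).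
    by rewrite ler_nat size_undup.
  rewrite size_map size_iota -natr1.
  have x0 : 0 < ln (1 + eps) by apply: lt_le_trans ln1; lra.
  have : 2 * (l / ln (1 + eps)) <= 3 * u.
    have : l / ln (1 + eps) <= l / (2 / 3 * eps).
      by rewrite ler_wpM2l ?lef_pV2 ?posrE ?mulr_gt0 //; lra.
    have -> : l / (2 / 3 * eps) = 3 / 2 * u by rewrite /u; field; rewrite gt_eqF.
    lra.
  have : 0 <= 2 * (l / ln (1 + eps)) by rewrite mulr_ge0 // divr_ge0 ?(ltW x0) //; lra.
  by move/ceil_nat_lt; rewrite -/l; lra.
have capE : gf_cap f M r eps p = r%:R * u * (card_I f M r eps p)%:R.
  by rewrite /gf_cap -/l /u; field; rewrite gt_eqF.
have ru : 0 <= r%:R * u by rewrite mulr_ge0 //; lra.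
have cap0 : 0 <= gf_cap f M r eps p by rewrite capE mulr_ge0.
have capu : gf_cap f M r eps p <= r%:R * u * (3 * u + 2) by rewrite capE ler_wpM2l.
have := card_gf_H cap0; have := card_gf_T f M eps p; rewrite -(ler_nat R).
have := card_gf_S f M r eps p r; rewrite -(ler_nat R).
have : #|gf_stored f M r eps p|%:R <= #|gf_T f M eps p|%:R + #|gf_S f M r eps p r|%:R +
    #|gf_H f M r eps p|%:R :> R.
  rewrite -!natrD ler_nat /gf_stored cardsU (leq_trans (leq_subr _ _)) // leq_add2r.
  by rewrite cardsU leq_subr.
have ru1 : u <= r%:R * u by rewrite ler_peMl //; lra.
have ru2 : r%:R * u <= r%:R * u * u by rewrite ler_peMr.
have ru3 : r%:R <= r%:R * u by rewrite ler_peMr.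
rewrite expr2 mulrA; lra.
Qed.

End Guarantee.

Theorem theorem3p1 (R : realType) :
  exists C : R, 0 < C /\
  forall (n : nat) (f : {set 'I_n} -> R) (M : {set {set 'I_n}}) (r : nat)
    (eps : R),
  (forall X : {set 'I_n}, 0 <= f X) -> submodular f ->
  matroid M -> matroid_rank M = r -> (0 < r)%N ->
  0 < eps < 2^-1 ->
  let eps' := 8 * Num.sqrt (2 * eps + 2 * r%:R / n%:R) in
  let XALG := fun pi : 'S_n => gf_output f M r eps (stream pi) in
  [/\ forall pi : 'S_n, XALG pi \in M,
      (2^-1 - eps') * opt f M <= expectation_perm (fun pi => f (XALG pi)) &
      forall pi : 'S_n,
        streams_with_memory pi
          (fun t => gf_stored f M r eps (take t (stream pi))) (XALG pi)
          (C * (r%:R * ln (r%:R / eps) ^+ 2 / eps ^+ 2))].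
Proof.
exists 9; split=> // n f M r eps f_ge0 /submodular_lattice sf matM rankM r0 eps_bounds eps' XALG.
have [e0 e2] := andP eps_bounds.
have outP pi := gf_outputP f r eps matM (stream pi).
have o0 : 0 <= opt f M.
  exact: le_trans (f_ge0 _) (le_opt f (matroid_set0 matM)).
split.
- by move=> pi; case: (outP pi).
(* If the radicand is at least 1, then [eps' >= 8] and the left-hand side is not positive. Otherwise
   the radicand is at most its root, and 3 times it is at most [eps']. *)
- have [d1|d1] := ltP (2 * eps + 2 * r%:R / n%:R) 1; last first.
    apply: (@le_trans _ _ 0).
      rewrite mulr_le0_ge0 // /eps'.
      have : 1 <= Num.sqrt (2 * eps + 2 * r%:R / n%:R) by rewrite -[leLHS]sqrtr1 ler_wsqrtr.
      lra.
    by rewrite /expectation_perm divr_ge0 // sumr_ge0.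
  apply: le_trans (expected_output_ge f_ge0 sf matM rankM r0 eps_bounds d1).
  rewrite ler_wpM2r // /eps'; set d := 2 * eps + _ in d1 *.
  have d0 : 0 <= d by rewrite addr_ge0 ?mulr_ge0 ?invr_ge0 // ltW.
  have s0 := sqrtr_ge0 d; have s2 := sqr_sqrtr d0.
  have s1 : Num.sqrt d <= 1 by rewrite -[leRHS]sqrtr1 ler_wsqrtr // ltW.
  have : d <= Num.sqrt d by rewrite -{1}s2 expr2 ler_piMl.
  lra.
- move=> pi; split.
  + by rewrite take0 gf_stored_nil.
  + move=> t; rewrite take_rcons_stream; apply: gf_stored_rcons.
    by rewrite mem_take_stream permK ltnn.
  + rewrite take_oversize ?size_stream //; by case: (outP pi) => _ [].
  + by move=> t _; apply: memory_bound.
Qed.
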